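(* Let $N\ge 2$, let $\tau$ be a partition of $N$, let $S\in\mathcal{Y}(\tau)$, let $m\ge 1$ be an integer, and let $\alpha=(m,0,\ldots,0)\in\mathbb{N}_0^N$. Let $\widehat{\tau}$ be obtained from $\tau$ by removing the box of $S$ containing $1$, and let $\mathcal{Z}(\widehat\tau)$ be the associated set of contents. Suppose $z\in\mathcal{Z}(\widehat{\tau})$, $n:=c(1,S)-z\neq 0$, and $\gcd(m,n)=1$. Then the nonsymmetric vector-valued Jack polynomial $J_{\alpha,S}$ is a singular polynomial for $\kappa=-\frac{m}{n}$; that is, $J_{\alpha,S}$ has no pole at $\kappa=-\frac mn$, and when evaluated at $\kappa=-\frac{m}{n}$ it satisfies $J_{\alpha,S}\mathcal{D}_i=0$ for all $1\le i\le N$.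
   Context: Tableaux. For a partition $\tau$ of $N$ with $\ell(\tau)$ nonzero parts, the Ferrers diagram has boxes $(i,j)$, $1\le i\le \ell(\tau)$, $1\le j\le\tau_i$. $\mathcal{Y}(\tau)$ is the set of reverse standard Young tableaux (RSYT) of shape $\tau$: fillings of the boxes by $1,\ldots,N$, each used once, with entries decreasing along each row and each column. For $S\in\mathcal{Y}(\tau)$ the entry $i$ is in box $(\mathrm{row}(i,S),\mathrm{col}(i,S))$ and its content is $c(i,S)=\mathrm{col}(i,S)-\mathrm{row}(i,S)$. Representation. $V_\tau$ is the vector space with basis $\mathcal{Y}(\tau)$ (over a field containing $\mathbb{Q}(\kappa)$). The symmetric group $\mathcal{S}_N$ (permutations composed as functions) acts on the right, $S\tau(w_1w_2)=(S\tau(w_1))\tau(w_2)$, determined by the action of $s_i=(i,i+1)$: with $b=c(i,S)-c(i+1,S)$ and $S^{(i)}$ denoting $S$ with $i$ and $i+1$ exchanged, $S\tau(s_i)=S$ if $b=1$; $S\tau(s_i)=-S$ if $b=-1$; $S\tau(s_i)=S^{(i)}+\frac1b S$ if $b\ge2$; $S\tau(s_i)=(1-\frac1{b^2})S^{(i)}+\frac1b S$ if $b\le-2$. Operators. $\mathcal{P}$ is the space of polynomials in $x_1,\ldots,x_N$, $\mathcal{P}_\tau=\mathcal{P}\otimes V_\tau$, and $x(i,j)$ denotes $x$ with coordinates $i,j$ exchanged. Operators act on the right. The Dunkl and Cherednik-Dunkl operators, $1\le i\le N$, are $$(p(x)\otimes S)\mathcal{D}_i=\frac{\partial p(x)}{\partial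 x_i}\otimes S+\kappa\sum_{j\ne i}\frac{p(x)-p(x(i,j))}{x_i-x_j}\otimes S\tau((i,j)),$$ $$(p(x)\otimes S)\mathcal{U}_i=(x_ip(x)\otimes S)\mathcal{D}_i-\kappa\sum_{j<i}p(x(i,j))\otimes S\tau((i,j)).$$ Orders and ranks. For $\alpha\in\mathbb{N}_0^N$, $\alpha^+$ is its nonincreasing rearrangement and $|\alpha|=\sum_i\alpha_i$. $\alpha\succ\beta$ means $\alpha\neq\beta$ and $\sum_{i\le j}\alpha_i\ge\sum_{i\le j}\beta_i$ for all $1\le j\le N$; $\alpha\vartriangleright\beta$ means $|\alpha|=|\beta|$ and either $\alpha^+\succ\beta^+$, or $\alpha^+=\beta^+$ and $\alpha\succ\beta$. The rank function is $r_\alpha(i)=\#\{j\le i:\alpha_j\ge\alpha_i\}+\#\{j>i:\alpha_j>\alpha_i\}$, a permutation. Jack polynomials. For $(\alpha,S)\in\mathbb{N}_0^N\times\mathcal{Y}(\tau)$ and $\kappa$ generic, $J_{\alpha,S}\in\mathcal{P}_\tau$ is the simultaneous eigenfunction $J_{\alpha,S}\mathcal{U}_i=\zeta_{\alpha,S}(i)J_{\alpha,S}$, $\zeta_{\alpha,S}(i)=\alpha_i+1+\kappa c(r_\alpha(i),S)$, $1\le i\le N$, of the form $J_{\alpha,S}=x^\alpha\otimes S\tau(r_\alpha)+\sum_{\beta\vartriangleleft\alpha}x^\beta\otimes v_{\alpha,\beta,S}(\kappa)$ with $v_{\alpha,\beta,S}(\kappa)\in V_\tau$ having coefficients rational in $\kappa$.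 Existence and uniqueness are known. The set $\mathcal{Z}(\widehat\tau)$. $\widehat\tau_i=\tau_i-1$ if $i=\mathrm{row}(1,S)$ and $\widehat\tau_i=\tau_i$ otherwise, $1\le i\le\ell(\tau)$. Let $1=i_1<i_2<\cdots<i_{k-1}$ be the indices in $\{1,\ldots,\ell(\tau)\}$ at which a maximal block of equal values of $(\widehat\tau_1,\ldots,\widehat\tau_{\ell(\tau)})$ starts (so $\widehat\tau_j=\widehat\tau_{i_s}$ for $i_s\le j<i_{s+1}$ and $\widehat\tau_{i_{s}}<\widehat\tau_{i_{s-1}}$), and $i_k=\ell(\tau)+1$. Then $\mathcal{Z}(\widehat\tau)=\{\widehat\tau_{i_s}+1-i_s:1\le s\le k-1\}$, together with the additional element $-\ell(\tau)$ if $\widehat\tau_{\ell(\tau)}\ge1$. *)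

(* Defs.v *)
(* Indices are 0-based: i : 'I_N stands for i + 1, and rows and columns of    *)
(* diagrams start at 0 (contents are unaffected by this shift).              *)
From HB Require Import structures.
From mathcomp Require Import all_boot all_order all_fingroup all_algebra.
From mathcomp Require Export mpoly.

Set Implicit Arguments.
Unset Strict Implicit.
Unset Printing Implicit Defensive.

Import GRing.Theory.
Local Open Scope ring_scope.

Definition is_partition (N : nat) (tau : seq nat) : bool :=
  [&& sorted geq tau, 0%N \notin tau & sumn tau == N].

(* A tableau is encoded by the position map of its entries: S i is the box   *)
(* (row, column) containing i.  The coordinates range over 'I_N since a      *)
(* partition of N has at most N rows and N columns.                          *)
Definition is_rsyt (N : nat) (tau : seq nat)
    (S : {ffun 'I_N -> 'I_N * 'I_N}) : bool :=
  [&& injectiveb S,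
      [forall b : 'I_N * 'I_N, (b \in codom S) == (b.2 < nth 0%N tau b.1)%N],
      [forall i, forall j,
        ((S i).1 == (S j).1) && ((S i).2 < (S j).2)%N ==> (j < i)%N]
    & [forall i, forall j,
        ((S i).2 == (S j).2) && ((S i).1 < (S j).1)%N ==> (j < i)%N]].

Record rsyt (N : nat) (tau : seq nat) : predArgType :=
  RSYT {box_of :> {ffun 'I_N -> 'I_N * 'I_N}; _ : is_rsyt tau box_of}.

HB.instance Definition _ N tau := [isSub for @box_of N tau].
HB.instance Definition _ N tau := [Finite of rsyt N tau by <:].

Section Tableaux.
Variables (N : nat) (tau : seq nat).
Implicit Type S : rsyt N tau.

Definition row_of S (i : 'I_N) : nat := (S i).1.
Definition col_of S (i : 'I_N) : nat := (S i).2.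
Definition content S (i : 'I_N) : int := (col_of S i)%:Z - (row_of S i)%:Z.

Definition swap_entries S (i j : 'I_N) : {ffun 'I_N -> 'I_N * 'I_N} :=
  [ffun k => S (tperm i j k)].

(* V_tau, as row vectors indexed by the reverse standard tableaux. *)
Definition ytdim : nat := #|{: rsyt N tau}|.

Definition ytvec S : 'rV[rat]_ytdim := delta_mx 0 (enum_rank S).

(* S^(i) for j = i + 1.  It is a reverse standard tableau as soon as the two *)
(* contents differ by at least 2, the only case in which it is used below.   *)
Definition ytvec_swap S (i j : 'I_N) : 'rV[rat]_ytdim :=
  oapp ytvec 0 (insub (swap_entries S i j)).

(* S tau(s_i) for j = i + 1.  For such entries b is never 0. *)
Definition simple_action S (i j : 'I_N) : 'rV[rat]_ytdim :=
  let b : int := content S i - content S j in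
  if b == 1 then ytvec S
  else if b == -1 then - ytvec S
  else if (2 <= b)%R then ytvec_swap S i j + (b%:~R)^-1 *: ytvec S
  else (1 - (b%:~R ^+ 2)^-1) *: ytvec_swap S i j + (b%:~R)^-1 *: ytvec S.

(* The matrix rho w acts on row vectors from the right and stands for tau(w).*)
(* MathComp composes permutations left to right: (w2 * w1)%g is the function *)
(* i |-> w1 (w2 i), that is the product w1 w2 of permutations as functions.  *)
Definition is_young_rep (rho : 'S_N -> 'M[rat]_ytdim) : Prop :=
  [/\ rho 1%g = 1%:M,
      forall w1 w2 : 'S_N, rho (w2 * w1)%g = rho w1 *m rho w2
    & forall i j : 'I_N, j = i.+1 :> nat ->
        forall S, ytvec S *m rho (tperm i j) = simple_action S i j].

End Tableaux.

Section DividedDifference.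
Variables (F : fieldType) (N : nat).

Lemma ddiff_exists (i j : 'I_N) (p : {mpoly F[N]}) :
  exists q : {mpoly F[N]}, q * ('X_i - 'X_j) == p - msym (tperm i j) p.
Proof.
set s := tperm i j.
pose A p := exists q : {mpoly F[N]}, q * ('X_i - 'X_j) == p - msym s p.
have AM p1 p2 : A p1 -> A p2 -> A (p1 * p2).
  move=> [q1 /eqP h1] [q2 /eqP h2].
  exists (q1 * p2 + msym s p1 * q2); apply/eqP.
  rewrite mulrDl -mulrA [p2 * _]mulrC mulrA h1 -mulrA h2 msymM.
  by rewrite mulrBl mulrBr addrA subrK.
have A1 : A 1 by exists 0; rewrite mul0r msym1 subrr.
have AX k : A 'X_k.
  have -> : A 'X_k = exists q : {mpoly F[N]},
    q * ('X_i - 'X_j) == 'X_k - 'X_(s k).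
    rewrite /A msymX /s tpermV.
    have -> : [multinom U_(k)%MM (s l) | l < N] = U_(s k)%MM; last by [].
    apply/mnmP=> l; rewrite !mnmE.
    by rewrite -(inj_eq (@perm_inj _ s)) /s tpermK.
  rewrite /s; case: tpermP => [->|->|_ _].
  - by exists 1; rewrite mul1r.
  - by exists (-1); rewrite mulN1r opprB.
  - by exists 0; rewrite mul0r subrr.
elim/mpolyind: p => [|c m p _ _ [q /eqP hq]].
  by exists 0; rewrite mul0r msym0 subrr.
have [r /eqP hr] : A 'X_[m].
  rewrite mpolyXE_id; elim/big_ind: _ => //= k _.
  by elim: (m k) => [|e IHe]; rewrite ?expr0 // exprS; apply: AM.
exists (c *: r + q); apply/eqP.
by rewrite mulrDl hq -scalerAl hr msymD msymZ scalerBr opprD addrACA.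
Qed.

(* (p(x) - p(x(i,j))) / (x_i - x_j) *)
Definition ddiff (i j : 'I_N) (p : {mpoly F[N]}) : {mpoly F[N]} :=
  xchoose (ddiff_exists i j p).

End DividedDifference.

(* F is a field of coefficients, d the dimension of V and rho w the matrix   *)
(* of tau(w); an element of P (x) V is a row vector of polynomials, and      *)
(* operators act on it from the right.                                       *)
Section Operators.
Variables (F : fieldType) (N d : nat) (rho : 'S_N -> 'M[F]_d) (kappa : F).

Definition tensor (p : {mpoly F[N]}) (v : 'rV[F]_d) : 'rV[{mpoly F[N]}]_d :=
  p *: map_mx (@mpolyC N F) v.

(* f |-> f (1 (x) tau(w)) *)
Definition act_right (w : 'S_N) (f : 'rV[{mpoly F[N]}]_d) :=
  f *m map_mx (@mpolyC N F) (rho w).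

Definition dunkl (i : 'I_N) (f : 'rV[{mpoly F[N]}]_d) : 'rV[{mpoly F[N]}]_d :=
  map_mx (mderiv i) f
  + kappa%:MP *:
      \sum_(j < N | j != i) act_right (tperm i j) (map_mx (ddiff i j) f).

Definition cherednik (i : 'I_N) (f : 'rV[{mpoly F[N]}]_d) :
    'rV[{mpoly F[N]}]_d :=
  dunkl i ('X_i *: f)
  - kappa%:MP *:
      \sum_(j < N | (j < i)%N)
         act_right (tperm i j) (map_mx (msym (tperm i j)) f).

End Operators.

Section Orders.
Variable N : nat.
Implicit Types a b : 'X_{1..N}.

Definition dominates (a b : seq nat) : bool :=
  (a != b) &&
  all (fun j => sumn (take j b) <= sumn (take j a))%N (iota 1 N).

Definition mplus a : seq nat := sort geq a.

(* mtri a b is a |> b *)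
Definition mtri a b : bool :=
  (mdeg a == mdeg b) &&
  (dominates (mplus a) (mplus b) || (mplus a == mplus b) && dominates a b).

(* The value r_a(i + 1), between 1 and N. *)
Definition rank_nat a (i : 'I_N) : nat :=
  (#|[set j : 'I_N | (j <= i) && (a i <= a j)]|
   + #|[set j : 'I_N | (i < j) && (a i < a j)]|)%N.

Lemma rank_natE a i :
  rank_nat a i =
  #|[set j : 'I_N | (a i < a j) || (a i == a j) && (j < i)]%N|.+1.
Proof.
rewrite /rank_nat (cardsD1 i) inE !leqnn add1n addSn; congr _.+1.
rewrite -cardsUI [X in (_ + X)%N](_ : _ = 0%N) ?addn0; last first.
  apply/eqP; rewrite cards_eq0 -subset0; apply/subsetP=> j.
  by rewrite !inE; case: ltnP; rewrite /= ?andbF.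
apply: eq_card => j; rewrite !inE.
have [-> | nij] := eqVneq j i; first by rewrite /= !ltnn ?andbF ?orbF.
case: (ltngtP j i) nij => [? _|? _|/val_inj ->]; rewrite ?eqxx //=;
  by case: (ltngtP (a i) (a j)).
Qed.

Lemma rank_lt a i : ((rank_nat a i).-1 < N)%N.
Proof.
rewrite rank_natE /= -[X in (_ < X)%N]card_ord -cardsT; apply: proper_card.
by apply/properP; split; [exact: subsetT | exists i; rewrite !inE // !ltnn andbF].
Qed.

Definition rank_fun a (i : 'I_N) : 'I_N := Ordinal (rank_lt a i).

Lemma rank_inj a : injective (rank_fun a).
Proof.
pose L i j := ((a i < a j) || (a i == a j) && (j < i))%N.
have Ltr i j k : L i j -> L j k -> L i k.
  rewrite /L => /orP[h1|/andP[/eqP h1 h2]] /orP[h3|/andP[/eqP h3 h4]].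
  - by rewrite (ltn_trans h1 h3).
  - by rewrite -h3 h1.
  - by rewrite h1 h3.
  - by rewrite h1 h3 eqxx (ltn_trans h4 h2) orbT.
have Llt i j : L i j -> (rank_nat a j < rank_nat a i)%N.
  move=> Lij; rewrite !rank_natE ltnS; apply: proper_card; apply/properP; split.
    by apply/subsetP=> k; rewrite !inE; apply: Ltr.
  by exists j; rewrite !inE ?ltnn ?andbF.
move=> i j /(congr1 val) /=.
have /prednK <- : (0 < rank_nat a i)%N by rewrite rank_natE.
move=> h; have {}h : rank_nat a i = rank_nat a j.
  by move: h; rewrite !rank_natE /= => ->.
apply/eqP; apply: contraT => nij.
have : L i j || L j i.
  rewrite /L; move: nij; rewrite -val_eqE /=.
  by case: (ltngtP (a i) (a j)); case: (ltngtP i j).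
by case/orP=> /Llt; rewrite h ltnn.
Qed.

Definition rank_perm a : 'S_N := perm (@rank_inj a).

End Orders.

(* Q(kappa) and its indeterminate. *)
Notation Qk := {fraction {poly rat}}.
Definition kappa_gen : Qk := tofrac 'X.
Definition constQk (c : rat) : Qk := tofrac c%:P.

Section Jack.
Variables (N : nat) (tau : seq nat).
Variable rho : 'S_N -> 'M[rat]_(ytdim N tau).

Definition gen_rep (w : 'S_N) : 'M[Qk]_(ytdim N tau) :=
  map_mx constQk (rho w).

Definition zeta (a : 'X_{1..N}) (S : rsyt N tau) (i : 'I_N) : Qk :=
  (a i)%:R + 1 + kappa_gen * (content S (rank_perm a i))%:~R.

Definition is_jack (a : 'X_{1..N}) (S : rsyt N tau)
    (J : 'rV[{mpoly Qk[N]}]_(ytdim N tau)) : Prop :=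
  (forall i : 'I_N,
     cherednik gen_rep kappa_gen i J = (zeta a S i)%:MP *: J) /\
  (exists v : 'X_{1..N} -> 'rV[Qk]_(ytdim N tau),
     J = tensor 'X_[a] (map_mx constQk (ytvec S) *m gen_rep (rank_perm a))
         + \sum_(b : 'X_{1..N < (mdeg a).+1} | mtri a b) tensor 'X_[b] (v b)).

(* The rational function f has no pole at k0 and its value there is c. *)
Definition frac_value (k0 : rat) (f : Qk) (c : rat) : Prop :=
  exists p q : {poly rat},
    [/\ q.[k0] != 0, f = tofrac p / tofrac q & c = p.[k0] / q.[k0]].

Definition specializes_to (k0 : rat)
    (J : 'rV[{mpoly Qk[N]}]_(ytdim N tau))
    (J0 : 'rV[{mpoly rat[N]}]_(ytdim N tau)) : Prop :=
  forall (s : 'I_(ytdim N tau)) (b : 'X_{1..N}),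
    frac_value k0 ((J 0 s)@_b) ((J0 0 s)@_b).

Definition singular_at (k0 : rat)
    (J : 'rV[{mpoly Qk[N]}]_(ytdim N tau)) : Prop :=
  exists2 J0, specializes_to k0 J J0 & forall i : 'I_N, dunkl rho k0 i J0 = 0.

End Jack.

Section ContentSet.
Variables (N : nat) (tau : seq nat) (S : rsyt N tau) (one : 'I_N).

Definition hat : seq nat :=
  [seq (nth 0 tau i - (i == row_of S one))%N | i <- iota 0 (size tau)].

Definition block_start (i : nat) : bool :=
  (i == 0%N) || (nth 0 hat i < nth 0 hat i.-1)%N.

(* With i 0-based, hat_i + 1 - (i + 1) = hat_i - i. *)
Definition Zhat : seq int :=
  [seq (nth 0%N hat i)%:Z - i%:Z | i <- iota 0 (size tau) & block_start i]
  ++ (if (1 <= last 0 hat)%N then [:: - (size tau)%:Z] else [::]).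

End ContentSet.

Definition first_entry (N : nat) (hN : (2 <= N)%N) : 'I_N := Ordinal (ltnW hN).

Definition row_mnm (N : nat) (m : nat) : 'X_{1..N} :=
  [multinom (if i == 0%N :> nat then m else 0%N) | i < N].

(* Main.v *)
(* A simultaneous eigenfunction of the Cherednik operators has a monomial of
   maximal weight, whose coefficient is a joint eigenvector of the Jucys-Murphy
   elements; so its spectrum is (b_i + 1 + kappa c(r_b(i), S')) for some exponent
   b and tableau S'.  For generic kappa this determines b; applied to J and its
   images under the steps f |-> f s_i - t f it gives J D_j = 0 for j > 1, by
   descending induction on j.  At kappa = -m/n, as gcd(m, n) = 1, it forces
   b = (m,0,..,0) or b = (0,..,m,..,0); the latter would put 2 in a box of content
   z removable from the shape of S without its entry 1, where a box of content z
   is addable.  Hence a nonzero eigenfunction has a nonzero coefficient of x_1^m,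
   which excludes a pole of J.  The polynomial J D_1 is again such an
   eigenfunction, of degree m - 1, and moving the exponent m from x_1 to x_N step
   by step computes its coefficient of x_1^(m-1): writing l(c) = m + kappa (c_1 - c),
   it is l(0) times the product over k > 1 of l(c_k - 1) l(c_k + 1) / l(c_k)^2,
   times that of x_1^m in J.  Only l(z) vanishes at -m/n, and a count of the boxes
   on three neighbouring diagonals shows that it occurs exactly once more in the
   numerator than in the denominator, so J D_1 vanishes there. *)
Require Import Defs.
From mathcomp Require Import all_boot all_order all_fingroup all_algebra.
From mathcomp Require Import zify ring.
Set Implicit Arguments.
Unset Strict Implicit.
Unset Printing Implicit Defensive.

Import Order.TTheory GRing.Theory Num.Theory.
Local Open Scope ring_scope.


(** * Lengths of neighbouring diagonals of a Young diagram *)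

Section Diagonals.
Local Open Scope nat_scope.
Implicit Types (B : nat -> nat -> bool) (M : nat).

Definition is_downset B : Prop :=
  forall r c r' c', r' <= r -> c' <= c -> B r c -> B r' c'.

Definition transpose_set B r c := B c r.

Definition updiag_size B M n : nat := \sum_(k < M) B k (k + n).

(** The diagonals below the main one are read in the transpose; [Negz n] is -(n+1), hence the shift
    [n.+1]. [M] truncates the count. *)
Definition diag_size B M (x : int) : nat :=
  match x with
  | Posz n => updiag_size B M n
  | Negz n => updiag_size (transpose_set B) M n.+1
  end.

Lemma downset_transpose B : is_downset B -> is_downset (transpose_set B).
Proof. by move=> dB r c r' c' h1 h2; apply: dB. Qed.

Lemma updiag_size_transpose0 B M :
  updiag_size (transpose_set B) M 0 = updiag_size B M 0.
Proof. by apply: eq_bigr => k _; rewrite addn0. Qed.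

Lemma updiag_size_mono B M n : is_downset B ->
  updiag_size B M n.+1 <= updiag_size B M n.
Proof.
move=> dB; apply: leq_sum => k _; case E: (B k (k + n.+1)) => //.
by rewrite (dB _ _ _ _ _ _ E) //; lia.
Qed.

(** A box of diagonal n outside row 0 has the box just above it on diagonal n+1, so at most the box
    in row 0 is lost. *)
Lemma updiag_size_step B M n : is_downset B ->
  updiag_size B M n <= updiag_size B M n.+1 + 1.
Proof.
move=> dB; rewrite /updiag_size; case: M => [|M]; first by rewrite !big_ord0.
rewrite big_ord_recl [X in _ <= X + _]big_ord_recr /=.
rewrite addnC leq_add ?leq_b1 // (leq_trans _ (leq_addr _ _)) //.
apply: leq_sum => k _; case E: (B _ _) => //.
by rewrite (dB _ _ _ _ _ _ E) // /bump /=; lia.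
Qed.

(** Away from the main diagonal the length stays or drops by one at each step, so the inner
    neighbour is longer by at most one and the outer neighbour is not longer. The main diagonal has
    two outer neighbours, which leaves room for the term [z == 0]. *)
Lemma diag_size_le B M (z : int) : is_downset B ->
  (z == 0%R) + diag_size B M (z - 1)%R + diag_size B M (z + 1)%R
    <= 2 * diag_size B M z + 1.
Proof.
move=> dB; have dB' := downset_transpose dB.
have h n := updiag_size_mono M n dB; have h' n := updiag_size_mono M n dB'.
have k n := updiag_size_step M n dB; have k' n := updiag_size_step M n dB'.
case: z => [[|n]|n].
- have := h 0; have := h' 0; rewrite updiag_size_transpose0.
  by rewrite eqxx sub0r add0r /=; lia.
- have -> : (n.+1%:Z - 1 = n%:Z)%R by lia.
  have -> : (n.+1%:Z + 1 = n.+2%:Z)%R by lia.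
  by have := h n.+1; have := k n; rewrite /=; lia.
- have -> : (Negz n - 1 = Negz n.+1)%R by lia.
  case: n => [|n]; last first.
    have -> : (Negz n.+1 + 1 = Negz n)%R by lia.
    by have := h' n.+2; have := k' n.+1; rewrite /=; lia.
  have -> : (Negz 0 + 1 = 0)%R by lia.
  have := h' 1; have := k' 0; rewrite updiag_size_transpose0.
  by rewrite /=; lia.
Qed.

Definition addable B r c : Prop :=
  [/\ ~~ B r c, r = 0 \/ B r.-1 c & c = 0 \/ B r c.-1].

Lemma updiag_size_ge B M n r : r <= M ->
  (forall k, k < r -> B k (k + n)) -> r <= updiag_size B M n.
Proof.
move=> rM hP.
rewrite /updiag_size -(big_mkord xpredT (fun k => nat_of_bool (B k (k + n)))).
rewrite (big_cat_nat (leq0n r) rM) /= -[X in X <= _]addn0 leq_add //.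
rewrite big_nat (eq_bigr (fun=> 1)) => [|k /hP -> //].
by rewrite -big_nat sum_nat_const_nat muln1 subn0.
Qed.

Lemma updiag_size_lt B M n r :
  (forall k, B k (k + n) -> k < r) -> updiag_size B M n <= r.
Proof.
move=> hP.
rewrite /updiag_size -(big_mkord xpredT (fun k => nat_of_bool (B k (k + n)))).
have le1 (p q : nat) : \sum_(p <= k < q) B k (k + n) <= q - p.
  rewrite -[q - p]muln1 -sum_nat_const_nat.
  by apply: leq_sum => k _; apply: leq_b1.
have [rM|/ltnW Mr] := leqP r M; last first.
  by rewrite (leq_trans _ Mr) // -[X in _ <= X]subn0 le1.
rewrite (big_cat_nat (leq0n r) rM) /= [X in _ + X]big_nat [X in _ + X]big1 => [|k].
  by rewrite addn0 -[X in _ <= X]subn0 le1.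
by case/andP=> rk _; case E: (B _ _) => //; have := hP _ E; rewrite ltnNge rk.
Qed.

Lemma addable_updiag B M r n : is_downset B -> r < M -> addable B r (r + n) ->
  [/\ updiag_size B M n <= r,
      0 < n -> r < updiag_size B M n.-1
    & r <= updiag_size B M n.+1].
Proof.
move=> dB rM [h0 h1 h2]; split.
- apply: updiag_size_lt => k hk; rewrite ltnNge; apply: contra h0 => rk.
  by apply: (dB _ _ _ _ _ _ hk); lia.
- move=> n0; apply: updiag_size_ge => // k hk; case: h2 => h2; first lia.
  by apply: (dB _ _ _ _ _ _ h2); lia.
apply: updiag_size_ge => [|k hk]; first exact: ltnW.
by case: h1 => h1; [lia | apply: (dB _ _ _ _ _ _ h1); lia].
Qed.

(** With d = min(r, c), the diagonal of the addable box has at most d boxes, its inner neighbour at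
    least d+1 and an outer neighbour at least d; for r = c both neighbours are outer. So contents of
    addable boxes attain the bound of [diag_size_le]. *)
Lemma addable_diag_size B M r c (z : int) : is_downset B ->
    r < M -> c < M -> addable B r c -> z = (c%:Z - r%:Z)%R ->
  2 * diag_size B M z + 1
    <= (z == 0%R) + diag_size B M (z - 1)%R + diag_size B M (z + 1)%R.
Proof.
move=> dB rM cM aB zdef; have dB' := downset_transpose dB.
have aB' : addable (transpose_set B) c r by case: aB.
have [rc|cr] := leqP r c.
  have zE : z = (c - r)%:Z by rewrite zdef; lia.
  have cE : c = r + (c - r) by lia.
  rewrite zE {zdef z zE}; move: (c - r) cE => n cE.
  subst c => {rc}.
  have [h1 h2 h3] := addable_updiag dB rM aB.
  case: n cM aB aB' h1 h2 h3 => [|n] ? aB aB' h1 h2 h3.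
    rewrite addn0 in aB'.
    have [||_ _] := @addable_updiag _ M r 0 dB' => //; first by rewrite addn0.
    by rewrite eqxx sub0r add0r /=; lia.
  have -> : (n.+1%:Z - 1 = n%:Z)%R by lia.
  have -> : (n.+1%:Z + 1 = n.+2%:Z)%R by lia.
  by have := h2 isT; rewrite /=; lia.
have zE : z = Negz (r - c).-1 by rewrite zdef; lia.
have rE : r = c + (r - c).-1.+1 by lia.
rewrite zE {zdef z zE}; move: (r - c).-1 rE => n rE.
subst r => {cr}.
have [h1 /(_ isT) h2 h3] := addable_updiag dB' cM aB'.
have -> : (Negz n - 1 = Negz n.+1)%R by lia.
case: n rM aB aB' h1 h2 h3 => [|n] ? aB aB' h1 h2 h3.
  rewrite /= updiag_size_transpose0 in h2.
  have -> : (Negz 0 + 1 = 0)%R by lia.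
  by rewrite /=; lia.
have -> : (Negz n.+1 + 1 = Negz n)%R by lia.
by rewrite /= in h2 *; lia.
Qed.

End Diagonals.

(** * Reverse standard tableaux: contents, and the diagrams of their larger entries *)

Section TableauShape.
Local Open Scope nat_scope.
Variables (N : nat) (tau : seq nat).
Hypothesis htau : is_partition N tau.
Implicit Types S : rsyt N tau.

Lemma nth_partition_le r r' : r <= r' -> nth 0 tau r' <= nth 0 tau r.
Proof.
move=> rr'; case/and3P: htau => srt _ _.
have [sr'|lt] := leqP (size tau) r'; first by rewrite nth_default.
have geq_trans : transitive geq by move=> a b c h1 h2; apply: leq_trans h2 h1.
apply: (sorted_leq_nth geq_trans (fun x => leqnn x)) => //.
by rewrite inE (leq_ltn_trans rr').
Qed.

Lemma box_in_shape S j : (S j).2 < nth 0 tau (S j).1.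
Proof.
have /and4P[_ /forallP/(_ (S j)) /eqP h _ _] := valP S.
by rewrite -h; apply: codom_f.
Qed.

Lemma rsyt_inj S : injective S.
Proof. by have /and4P[/injectiveP h _ _ _] := valP S. Qed.

Lemma size_partition : size tau <= N.
Proof.
case/and3P: htau => _ h0 /eqP <-.
elim: tau h0 => //= a t IH; rewrite inE negb_or => /andP[a0 /IH h].
by rewrite -add1n leq_add // lt0n eq_sym.
Qed.

Lemma nth_partition_leN r : nth 0 tau r <= N.
Proof.
have [sr|rs] := leqP (size tau) r; first by rewrite nth_default.
case/and3P: htau => _ h0 /eqP <-; rewrite -(cat_take_drop r tau) sumn_cat.
by rewrite (drop_nth 0 rs) /= nth_cat size_take rs ltnn subnn /=; lia.
Qed.

Lemma entry_exists S r c : c < nth 0 tau r ->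
  exists j : 'I_N, (S j).1 = r :> nat /\ (S j).2 = c :> nat.
Proof.
move=> h; have rs : r < size tau.
  by rewrite ltnNge; apply/negP => sr; rewrite nth_default in h.
have rN := leq_trans rs size_partition.
have cN := leq_trans h (nth_partition_leN r).
have /and4P[_ /forallP/(_ (Ordinal rN, Ordinal cN)) /eqP /= e _ _] := valP S.
have /codomP[j ej] : (Ordinal rN, Ordinal cN) \in codom S by rewrite e.
by exists j; rewrite -ej.
Qed.

(** The box in the row of [j'] and the column of [j] belongs to the shape; the comparison goes
    through its entry [i], once along a row and once along a column. *)
Lemma rsyt_decr S j j' : (S j').1 <= (S j).1 -> (S j').2 <= (S j).2 -> j <= j'.
Proof.
move=> hr hc; have /and4P[_ _ hrow hcol] := valP S.
have [i [i1 i2]] : exists i, (S i).1 = (S j').1 :> nat /\ (S i).2 = (S j).2 :> nat.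
  apply: entry_exists; exact: leq_trans (box_in_shape S j) (nth_partition_le hr).
have ij' : i <= j'.
  have [e|ne] := eqVneq ((S j').2 : nat) (S j).2.
    have -> // : i = j'; apply: (@rsyt_inj S).
    by rewrite [S i]surjective_pairing [S j']surjective_pairing; congr pair;
      apply: val_inj; rewrite /= ?i1 ?i2 ?e.
  move/forallP/(_ j')/forallP/(_ i)/implyP: hrow => H; apply: ltnW; apply: H.
  by rewrite -val_eqE /= i1 eqxx i2 ltn_neqAle ne hc.
apply: leq_trans ij'.
have [e|ne] := eqVneq ((S j').1 : nat) (S j).1.
  have -> // : i = j; apply: (@rsyt_inj S).
  by rewrite [S i]surjective_pairing [S j]surjective_pairing; congr pair;
    apply: val_inj; rewrite /= ?i1 ?i2 ?e.
move/forallP/(_ i)/forallP/(_ j)/implyP: hcol => H; apply: ltnW; apply: H.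
by rewrite -val_eqE /= i2 eqxx i1 ltn_neqAle ne hr.
Qed.

(** On a common diagonal the larger entry [j] would be the upper left one. The box in the row of [i]
    and the column of [j] would then hold an entry between i and i+1, but it is the box of
    neither. *)
Lemma content_succ_neq S (i j : 'I_N) : j = i.+1 :> nat ->
  content S i != content S j.
Proof.
move=> ji; apply/eqP => e.
have : content S i = content S j by [].
rewrite /content /row_of /col_of => {}e.
have [le|lt] := leqP (S i).1 (S j).1.
  by have : j <= i; [apply: (@rsyt_decr S) | ]; lia.
have [|k [k1 k2]] := @entry_exists S (S i).1 (S j).2.
  by have := box_in_shape S i; lia.
have h1 : i <= k by apply: (@rsyt_decr S); lia.
have h2 : k <= j by apply: (@rsyt_decr S); lia.
have [ki|kj] : k = i \/ k = j.
- have [h|h] : (k = i :> nat) \/ (k = j :> nat) by lia.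
    by left; apply: val_inj.
  by right; apply: val_inj.
- by move: k2; rewrite ki; lia.
- by move: k1; rewrite kj; lia.
Qed.

Lemma content_last S (i : 'I_N) : i.+1 = N -> content S i = 0%R.
Proof.
move=> iN; have [|k [k1 k2]] := @entry_exists S 0 0.
  exact: leq_ltn_trans (leq0n _) (leq_trans (box_in_shape S i) (nth_partition_le _)).
have ik : i <= k by apply: (@rsyt_decr S); rewrite ?k1 ?k2.
have -> : i = k by apply: val_inj => /=; have := ltn_ord k; lia.
by rewrite /content /row_of /col_of k1 k2.
Qed.

(** The diagram left after deleting the entries below [t], again a Young diagram because entries
    decrease along rows and columns. Indices start at 0, so [t] = 1 and [t] = 2 delete the first one
    and the first two entries. *)
Definition boxes_from S t r c : bool :=
  [exists j : 'I_N, [&& t <= j, (S j).1 == r :> nat & (S j).2 == c :> nat]].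

Lemma boxes_from_downset S t : is_downset (boxes_from S t).
Proof.
move=> r c r' c' hr hc /existsP[j /and3P[tj /eqP jr /eqP jc]].
have [|k [k1 k2]] := @entry_exists S r' c'.
  rewrite (leq_ltn_trans hc) // (leq_trans _ (nth_partition_le hr)) //.
  by rewrite -jr -jc box_in_shape.
apply/existsP; exists k; rewrite k1 k2 !eqxx (leq_trans tj) //.
by apply: (@rsyt_decr S); rewrite ?k1 ?k2 ?jr ?jc.
Qed.

Definition content_count S t (x : int) : nat :=
  #|[set j : 'I_N | (t <= j) && (content S j == x)]|.

Lemma boxes_fromE S t r c : boxes_from S t r c =
  \sum_(j : 'I_N | t <= j) ((S j).1 == r :> nat) && ((S j).2 == c :> nat) :> nat.
Proof.
rewrite /boxes_from; case: existsP => [[j /and3P[tj /eqP jr /eqP jc]]|h].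
  rewrite (bigD1 j) //= jr jc !eqxx big1 // => k /andP[_ kj].
  apply/eqP; rewrite eqb0; apply: contra kj => /andP[/eqP kr /eqP kc].
  apply/eqP/(@rsyt_inj S); rewrite [S k]surjective_pairing [S j]surjective_pairing.
  by congr pair; apply: val_inj; rewrite /= ?jr ?jc.
rewrite big1 // => j tj; apply/eqP; rewrite eqb0; apply/negP => /andP[h1 h2].
by apply: h; exists j; rewrite tj h1.
Qed.

Lemma content_countE S t x :
  content_count S t x = diag_size (boxes_from S t) N.+1 x.
Proof.
(* Exchanging the sums: each entry has a single coordinate [f j], so it is met once if its box is on
   the diagonal and never otherwise. *)
have key (f g : 'I_N -> nat) n : (forall j, f j < N.+1) ->
    \sum_(k < N.+1) \sum_(j : 'I_N | t <= j) (f j == k :> nat) && (g j == k + n)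
    = #|[set j : 'I_N | (t <= j) && (g j == f j + n)]|.
  move=> hf; rewrite exchange_big -sum1_card big_mkcond [RHS]big_mkcond /=.
  apply: eq_bigr => j _; rewrite inE; case: (t <= j) => //=.
  rewrite (bigD1 (Ordinal (hf j))) //= eqxx /= big1 ?addn0 => [|k kj].
    by case: (_ == _).
  rewrite (_ : (f j == k) = false) //; apply: contraNF kj => /eqP e.
  by apply/eqP/val_inj.
rewrite /content_count; case: x => n /=; rewrite /updiag_size.
  under [RHS]eq_bigr do rewrite boxes_fromE.
  rewrite (key (fun j => nat_of_ord (S j).1) (fun j => nat_of_ord (S j).2)).
    by apply: eq_card => j; rewrite !inE /content /row_of /col_of; lia.
  by move=> j; rewrite ltnS ltnW.
rewrite /transpose_set; under [RHS]eq_bigr do rewrite boxes_fromE.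
under [RHS]eq_bigr => k _ do under eq_bigr => j _ do rewrite andbC.
rewrite (key (fun j => nat_of_ord (S j).2) (fun j => nat_of_ord (S j).1)).
  by apply: eq_card => j; rewrite !inE /content /row_of /col_of; lia.
by move=> j; rewrite ltnS ltnW.
Qed.

Lemma content_count_le S t z :
  (z == 0%R) + content_count S t (z - 1)%R + content_count S t (z + 1)%R
    <= 2 * content_count S t z + 1.
Proof. by rewrite !content_countE; apply/diag_size_le/boxes_from_downset. Qed.

Lemma boxes_from0 S r c : boxes_from S 0 r c = (c < nth 0 tau r).
Proof.
apply/existsP/idP => [[j /and3P[_ /eqP <- /eqP <-]]|]; first exact: box_in_shape.
by move/(entry_exists S) => [j [h1 h2]]; exists j; rewrite h1 h2 !eqxx.
Qed.

Lemma content_count0 S S' x : content_count S 0 x = content_count S' 0 x.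
Proof.
have h r c : boxes_from S 0 r c = boxes_from S' 0 r c by rewrite !boxes_from0.
rewrite !content_countE; case: x => n /=;
  by apply: eq_bigr => k _; rewrite /transpose_set h.
Qed.

Lemma nth_hat S (one : 'I_N) r :
  nth 0 (hat S one) r = nth 0 tau r - (r == row_of S one).
Proof.
rewrite /hat; have [sr|rs] := leqP (size tau) r.
  by rewrite !nth_default ?sub0n // size_map size_iota.
by rewrite (nth_map 0) ?size_iota // nth_iota.
Qed.

Lemma boxes_from1 S (one : 'I_N) r c : one = 0 :> nat ->
  boxes_from S 1 r c = (c < nth 0 (hat S one) r).
Proof.
move=> one0; rewrite nth_hat.
(* The smallest entry ends its row, so shortening that row by one deletes exactly its box. *)
have colE : (S one).2.+1 = nth 0 tau (S one).1.
  apply/eqP; rewrite eqn_leq box_in_shape /= leqNgt; apply/negP => h.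
  have [k [k1 k2]] := entry_exists S h.
  have h1 : k <= one by apply: (@rsyt_decr S); rewrite ?k1 ?k2.
  have e : k = one by apply: val_inj => /=; lia.
  by move: k2; rewrite e; lia.
have -> : boxes_from S 1 r c
    = boxes_from S 0 r c && ~~ ((r == (S one).1 :> nat) && (c == (S one).2 :> nat)).
  apply/existsP/andP => [[j /and3P[j0 /eqP jr /eqP jc]]|[/existsP[j]]].
    split; first by apply/existsP; exists j; rewrite jr jc !eqxx.
    apply/negP => /andP[/eqP h1 /eqP h2].
    suff e : j = one by rewrite e one0 in j0.
    apply: (@rsyt_inj S); rewrite [S j]surjective_pairing [S one]surjective_pairing.
    by congr pair; apply: val_inj; rewrite /= ?jr ?jc.
  case/and3P=> _ jr jc h; exists j; rewrite jr jc !andbT lt0n.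
  apply: contra h => /eqP j0; have <- : j = one by apply: val_inj; rewrite /= j0.
  by rewrite eq_sym jr eq_sym jc.
rewrite boxes_from0 /row_of; case: eqP => [->|] /=; last by rewrite subn0 andbT.
by move: colE; lia.
Qed.

(** The members of [Zhat] are contents of boxes addable to the shape without its first entry: the
    start r of a block gives the box (r, hat_r), and the extra element gives the first box of a new
    row below a nonempty last row. *)
Lemma Zhat_content_count S (one : 'I_N) z : one = 0 :> nat ->
    z \in Zhat S one ->
  2 * content_count S 1 z + 1
    <= (z == 0%R) + content_count S 1 (z - 1)%R + content_count S 1 (z + 1)%R.
Proof.
move=> one0 hz.
have [r [rs hr zE]] : exists r, [/\ r <= size tau,
    r = 0 \/ nth 0 (hat S one) r < nth 0 (hat S one) r.-1
    & z = ((nth 0 (hat S one) r)%:Z - r%:Z)%R].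
  move: hz; rewrite mem_cat => /orP[/mapP[r]|].
    rewrite mem_filter mem_iota add0n /block_start => /andP[hr /andP[_ rs]] ->.
    exists r; split=> //; first exact: ltnW.
    by case/orP: hr => [/eqP|]; [left | right].
  have sh : size (hat S one) = size tau by rewrite size_map size_iota.
  case: ifP => //; rewrite inE => h /eqP ->; exists (size tau).
  rewrite [nth _ _ (size tau)]nth_default ?sh //; split=> //; last lia.
  by right; rewrite -sh nth_last.
rewrite !content_countE.
apply: (addable_diag_size (r := r) (c := nth 0 (hat S one) r)) => //.
- exact: boxes_from_downset.
- exact: leq_trans rs size_partition.
- rewrite ltnS nth_hat (leq_trans (leq_subr _ _)) //; exact: nth_partition_leN.
split; rewrite !(boxes_from1 _ _ _ one0) ?ltnn //.
by case: (nth 0 (hat S one) r) => [|c]; [left | right].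
Qed.

End TableauShape.

(** Both tableaux have the same shape. Counting content z in it, where [S'] has z at [two] and [S]
    does not have it at [one], forces content z on entry [k] of [S]. With P the content counts of
    the remaining entries, [Zhat_content_count] for [S] gives 2(P(z) + 1) + 1 as a lower bound for
    (z = 0) + P(z-1) + P(z+1), while the diagram of the entries of [S'] from [two] on, with [two]
    removed, gives the upper bound 2P(z) + 1. *)
Lemma no_exchanged_content N tau (htau : is_partition N tau) (S S' : rsyt N tau)
    (one two k : 'I_N) (w : 'S_N) (z : int) :
    one = 0%N :> nat -> two = 1%N :> nat -> z \in Zhat S one ->
    z != content S one -> k != one -> w k = one -> w one = two ->
    content S' two = z ->
    (forall j, j != one -> j != k -> content S' (w j) = content S j) ->
  False.
Proof.
move=> one0 two1 hz zS kone wk wone ztwo hw.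
pose P x := #|[set j | [&& j != one, j != k & content S j == x]]|.
have ge1 (j : 'I_N) : (1 <= j)%N = (j != one).
  by rewrite -val_eqE /= one0 lt0n.
have e2 x : content_count S' 2 x = P x.
  rewrite /P -(card_imset _ (@perm_inj _ w)); apply: eq_card => j'.
  rewrite -[j'](permKV w) (mem_imset _ _ (@perm_inj _ w)) !inE.
  move: (_ j') => j; rewrite ltn_neqAle ge1 -[X in X != _]two1 val_eqE.
  have -> : (two == w j) = (j == one).
    by rewrite -wone (inj_eq (@perm_inj _ w)) eq_sym.
  have -> : (w j == one) = (j == k) by rewrite -wk (inj_eq (@perm_inj _ w)).
  rewrite -andbA; have [|j1] //= := boolP (j == one).
  by have [|jk] //= := boolP (j == k); rewrite hw.
have e1 x : content_count S 1 x = (P x + (content S k == x))%N.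
  rewrite /content_count (cardsD1 k) inE ge1 kone addnC; congr addn.
  by apply: eq_card => j; rewrite !inE ge1 [in RHS]andbCA.
have e0 x (T : rsyt N tau) :
    content_count T 0 x = (content_count T 1 x + (content T one == x))%N.
  rewrite /content_count (cardsD1 one) inE addnC; congr addn.
  by apply: eq_card => j; rewrite !inE ge1.
have e0' x : content_count S' 1 x = (content_count S' 2 x + (content S' two == x))%N.
  rewrite /content_count (cardsD1 two) inE two1 addnC; congr addn.
  apply: eq_card => j; rewrite !inE -val_eqE /= two1.
  by rewrite [in RHS]ltn_neqAle [in RHS]eq_sym andbA.
have hc x := content_count0 htau S S' x.
have := content_count_le htau S' 2 z.
have := Zhat_content_count htau one0 hz.
have := hc z; rewrite !e0 !e0' !e1 !e2 ztwo eqxx.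
have zM : z == (z - 1)%R = false by lia.
have zP : z == (z + 1)%R = false by lia.
rewrite eq_sym in zS; rewrite (negbTE zS).
have [->|kz] := eqVneq (content S k) z; rewrite ?zM ?zP; last lia.
by move: (P z) (P (z - 1)) (P (z + 1)) => p p1 p2 _; rewrite /=; lia.
Qed.

(** * Jucys-Murphy elements act on tableaux by contents *)

Section JucysMurphy.
Variables (N : nat) (tau : seq nat) (rho : 'S_N -> 'M[rat]_(ytdim N tau)).
Hypotheses (htau : is_partition N tau) (hrho : is_young_rep rho).
Implicit Types S : rsyt N tau.

(** The four cases of the action in one form. Of the exchanged tableau only its content at [j] is
    recorded, which is what the recursion for Jucys-Murphy elements uses; for b = 1 or b = -1 the
    w-part is zero. *)
Lemma simple_action_decomp S (i j : 'I_N) : j = i.+1 :> nat ->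
  let b : rat := (content S i - content S j)%:~R in
  exists a w, simple_action S i j = a *: w + b^-1 *: ytvec S
    /\ (w = 0 \/ exists2 S', w = ytvec S' & content S' j = content S i).
Proof.
move=> ji b; have hw : ytvec_swap S i j = 0 \/
    exists2 S', ytvec_swap S i j = ytvec S' & content S' j = content S i.
  rewrite /ytvec_swap; case: insubP => [S' _ eS'|_]; last by left.
  right; exists S' => //.
  have e : S' j = S i by rewrite -[S' j]/((val S') j) eS' ffunE tpermR.
  by rewrite /content /row_of /col_of e.
rewrite /simple_action -/b; case: ifP => [/eqP b1|_].
  by exists 0, 0; split; [rewrite /b b1 scale0r add0r invr1 scale1r | left].
case: ifP => [/eqP b1|_].
  by exists 0, 0; split; [rewrite /b b1 scale0r add0r invrN1 scaleN1r | left].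
case: ifP => _; last by exists (1 - (b ^+ 2)^-1), (ytvec_swap S i j).
by exists 1, (ytvec_swap S i j); rewrite scale1r.
Qed.

Lemma ytvec_jucys_murphy S (i : 'I_N) :
  ytvec S *m (\sum_(l < N | (i < l)%N) rho (tperm i l))
    = (content S i)%:~R *: ytvec S.
Proof.
case: hrho => rho1 rhoM rho_simple.
have [k] := ubnP (N - i); elim: k i S => // k IH i S ik.
have [iN|iN] := eqVneq i.+1 N.
  rewrite (content_last htau S iN) scale0r big_pred0 ?mulmx0 // => l.
  by have := ltn_ord l; lia.
have jN : (i.+1 < N)%N by have := ltn_ord i; lia.
pose j := Ordinal jN; have ij : i != j by rewrite -val_eqE /=; lia.
pose s := tperm i j; set v := ytvec S.
have ss : rho s *m rho s = 1%:M by rewrite -rhoM tperm2 rho1.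
(* The recursion w_i = s + s w_j s for Jucys-Murphy elements, from (i l) = s (j l) s for l > j. It
   drives a descending induction on [i] that starts with the empty sum. *)
have -> : \sum_(l < N | (i < l)%N) rho (tperm i l)
    = rho s + rho s *m (\sum_(l < N | (j < l)%N) rho (tperm j l)) *m rho s.
  rewrite (bigD1 j) //=; congr (_ + _); rewrite mulmx_sumr mulmx_suml.
  apply: eq_big => l; first by rewrite -val_eqE /=; lia.
  move=> /andP[il lj].
  have -> : tperm i l = (s * (tperm j l * s))%g.
    rewrite -{1}[s]tpermV -/(conjg _ _) tpermJ tpermR.
    by rewrite tpermD // [_ == l]eq_sym // neq_ltn il orbT.
  by rewrite 2!rhoM -!mulmxA.
have [a [w [vs hw]]] := simple_action_decomp S (erefl : j = i.+1 :> nat).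
rewrite -rho_simple // -/s -/v in vs.
set b : rat := (content S i - content S j)%:~R in vs.
have b0 : b != 0.
  by rewrite intr_eq0 subr_eq0; apply: (content_succ_neq htau).
have IHj S' := IH j S' (ltac:(rewrite /=; lia)).
have hwj : w *m (\sum_(l < N | (j < l)%N) rho (tperm j l))
    = (content S i)%:~R *: w.
  by case: hw => [->|[S' -> <-]]; rewrite ?mul0mx ?scaler0.
(* The element for [j] acts by c(i) on the w-part of [v *m rho s] and by c(j) = c(i) - b on the
   multiple v/b; the difference is exactly -v, which the summand s of the recursion cancels. *)
have key : v *m rho s *m (\sum_(l < N | (j < l)%N) rho (tperm j l))
    = (content S i)%:~R *: (v *m rho s) - v.
  rewrite vs mulmxDl -!scalemxAl hwj IHj scalerDr !scalerA -addrA.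
  congr (_ + _); first by rewrite mulrC.
  rewrite -/v -{3}[v]scale1r -scalerBl; congr (_ *: _).
  have -> : (content S j)%:~R = (content S i)%:~R - b.
    by rewrite /b intrB opprB addrCA subrr addr0.
  by rewrite mulrBr mulVf // mulrC.
by rewrite mulmxDr !mulmxA key mulmxBl -scalemxAl -mulmxA ss mulmx1 addrC subrK.
Qed.

End JucysMurphy.

(** * Identities and coefficients of divided differences *)

Section DividedDifferences.
Variables (F : fieldType) (N : nat).
Implicit Types (p q : {mpoly F[N]}) (m : 'X_{1..N}).

Lemma ddiffP (i j : 'I_N) p :
  ddiff i j p * ('X_i - 'X_j) = p - msym (tperm i j) p.
Proof. exact/eqP/(xchooseP (ddiff_exists i j p)). Qed.

Lemma msymX1 (s : 'S_N) k : msym s 'X_k = 'X_(s k) :> {mpoly F[N]}.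
Proof.
rewrite msymX; congr 'X_[_]; apply/mnmP => l; rewrite !mnmE.
by rewrite -[l in RHS](permKV s) (inj_eq (@perm_inj _ s)).
Qed.

Lemma mpolyX_sub_neq0 (i j : 'I_N) : i != j -> 'X_i - 'X_j != 0 :> {mpoly F[N]}.
Proof.
move=> ij; apply/negP => /eqP/(congr1 (mcoeff U_(i)%MM)).
rewrite mcoeffB !mcoeffXU mcoeff0 eqxx eq_sym (negbTE ij) subr0.
by apply/eqP/oner_neq0.
Qed.

Lemma ddiff_uniq (i j : 'I_N) p q : i != j ->
  q * ('X_i - 'X_j) = p - msym (tperm i j) p -> ddiff i j p = q.
Proof.
by move=> /mpolyX_sub_neq0 ij; rewrite -ddiffP => /(mulIf ij).
Qed.

Lemma ddiff_linear (i j : 'I_N) c p q : i != j ->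
  ddiff i j (c *: p + q) = c *: ddiff i j p + ddiff i j q.
Proof.
move=> ij; apply: ddiff_uniq => //.
have h : (c *: ddiff i j p) * ('X_i - 'X_j) = c *: (p - msym (tperm i j) p).
  by rewrite -ddiffP; exact/esym/scalerAl.
by rewrite mulrDl h ddiffP msymD msymZ scalerBr opprD addrACA.
Qed.

Lemma ddiff_msym (i j : 'I_N) (s : 'S_N) p : i != j ->
  ddiff i j (msym s^-1 p) = msym s^-1 (ddiff (s i) (s j) p).
Proof.
move=> ij; apply: ddiff_uniq => //.
have -> : 'X_i - 'X_j = msym s^-1 ('X_(s i) - 'X_(s j)) :> {mpoly F[N]}.
  by rewrite msymB !msymX1 !permK.
rewrite -msymM ddiffP.
have -> : tperm (s i) (s j) = (s^-1 * tperm i j * s)%g.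
  by rewrite -tpermJ /conjg mulgA.
by rewrite msymB -2!msymMm mulgK.
Qed.

Lemma ddiff_sym (i j : 'I_N) p : i != j ->
  msym (tperm i j) (ddiff i j p) = ddiff i j p.
Proof.
move=> ij; symmetry; apply: ddiff_uniq => //.
have h : 'X_i - 'X_j = - msym (tperm i j) ('X_i - 'X_j) :> {mpoly F[N]}.
  by rewrite msymB !msymX1 tpermL tpermR opprB.
rewrite h mulrN -msymM ddiffP msymB -msymMm tperm2.
by rewrite (_ : msym 1 p = p) ?opprB // msym1m.
Qed.

Lemma ddiff_mulX (i j : 'I_N) p : i != j ->
  ddiff i j ('X_i * p) = 'X_i * ddiff i j p + msym (tperm i j) p.
Proof.
move=> ij; apply: ddiff_uniq => //.
rewrite mulrDl -mulrA ddiffP msymM msymX1 tpermL; ring.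
Qed.

Lemma ddiff_mulXr (i j : 'I_N) p : i != j ->
  ddiff i j ('X_j * p) = 'X_j * ddiff i j p - msym (tperm i j) p.
Proof.
move=> ij; apply: ddiff_uniq => //.
rewrite mulrBl -mulrA ddiffP msymM msymX1 tpermR; ring.
Qed.

Lemma ddiff_mulXD (i j k : 'I_N) p : i != j -> k != i -> k != j ->
  ddiff i j ('X_k * p) = 'X_k * ddiff i j p.
Proof.
move=> ij ki kj; apply: ddiff_uniq => //.
by rewrite -mulrA ddiffP msymM msymX1 tpermD 1?eq_sym // mulrBr.
Qed.

Lemma mcoeffMX_eq0 (i : 'I_N) p m : m i = 0%N -> (p * 'X_i)@_m = 0.
Proof.
move=> mi; apply/eqP; rewrite mcoeff_eq0 (perm_mem (msuppMX _ _)).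
apply/negP => /mapP[m' _ /(congr1 (fun m : 'X_{1..N} => m i))].
by rewrite mi mnmDE mnm1E eqxx.
Qed.

(** Comparing coefficients of x^(m + e_i) in q (x_i - x_j) = p - p(x(i,j)) expresses q_m through the
    coefficient of q at m + e_i - e_j. Iterating lowers the exponent at [j] to 0, where the
    recursion stops; as k is at most m_j, the subtraction of exponents is exact. *)
Lemma mcoeff_ddiff (i j : 'I_N) p m : i != j ->
  (ddiff i j p)@_m = \sum_(k < (m j).+1)
     (p - msym (tperm i j) p)@_(m + U_(i) *+ k.+1 - U_(j) *+ k).
Proof.
move=> ij; have [e] := ubnP (m j); elim: e m => // e IH m me.
have key : (ddiff i j p)@_m - (ddiff i j p * 'X_j)@_(m + U_(i))
    = (p - msym (tperm i j) p)@_(m + U_(i)).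
  by rewrite -ddiffP mulrBr mcoeffB addmC mcoeffMX.
rewrite big_ord_recl /=.
have -> : (m + U_(i) *+ 1 - U_(j) *+ 0)%MM = (m + U_(i))%MM.
  by apply/mnmP => l; rewrite !mnmE subn0.
rewrite -key -addrA; apply/esym; rewrite -[RHS]addr0; congr (_ + _).
case mj : (m j) => [|a].
  rewrite big_ord0 addr0 mcoeffMX_eq0 ?oppr0 //.
  by rewrite mnmDE mj mnm1E (negbTE ij).
have mE : (m + U_(i))%MM = (U_(j) + (m - U_(j) + U_(i)))%MM.
  apply/mnmP => l; rewrite !mnmE; have [<-|] := eqVneq j l; rewrite ?mj; lia.
have aE : (m - U_(j) + U_(i))%MM j = a.
  by rewrite !mnmE eqxx mj (negbTE ij) addn0 subn1.
rewrite mE mcoeffMX IH; last by rewrite aE -ltnS -mj.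
rewrite aE.
apply/eqP; rewrite addrC subr_eq0; apply/eqP/eq_bigr => k _; congr (_@__).
apply/mnmP => l; rewrite !(mulmnE, mnmE) /bump /=; have [<-|] := eqVneq j l.
  by rewrite (negbTE ij) mj; lia.
by case: (i == l); lia.
Qed.

End DividedDifferences.

Lemma scaler_comb3 (R : comPzRingType) (V : lmodType R) (a x y : R)
    (f g f1 g1 f2 g2 : V) :
  a *: f + g + x *: (a *: f1 + g1) + y *: (a *: f2 + g2)
    = a *: (f + x *: f1 + y *: f2) + (g + x *: g1 + y *: g2).
Proof.
rewrite !scalerDr !scalerA [x * a]mulrC [y * a]mulrC.
by rewrite [_ + g + (_ + _)]addrACA [LHS]addrACA.
Qed.

(** * Commutation relations of Dunkl operators, Cherednik operators and permutations *)

Section OperatorAlgebra.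
Local Opaque ddiff msym mderiv.
Variables (F : fieldType) (N d : nat) (rho : 'S_N -> 'M[F]_d) (kappa : F).
Hypothesis rho1 : rho 1%g = 1%:M.
Hypothesis rhoM : forall w1 w2 : 'S_N, rho (w2 * w1)%g = rho w1 *m rho w2.
Implicit Types (f g : 'rV[{mpoly F[N]}]_d) (w : 'S_N) (i j k : 'I_N).

Definition mpoly_linear (phi : {mpoly F[N]} -> {mpoly F[N]}) : Prop :=
  forall c p q, phi (c *: p + q) = c *: phi p + phi q.

Lemma msym_mpoly_linear w : mpoly_linear (msym w).
Proof. by move=> c p q; rewrite msymD msymZ. Qed.

Lemma mderiv_mpoly_linear i : mpoly_linear (mderiv i).
Proof. by move=> c p q; rewrite mderivD mderivZ. Qed.

Lemma ddiff_mpoly_linear i j : i != j -> mpoly_linear (ddiff i j).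
Proof. by move=> ij c p q; apply: ddiff_linear. Qed.

Lemma mpoly_linear0 phi : mpoly_linear phi -> phi 0 = 0.
Proof. by move=> h; have := h (-1) 0 0; rewrite scaler0 addr0 scaleN1r addNr. Qed.

Lemma map_mx_linear phi c f g : mpoly_linear phi ->
  map_mx phi (c%:MP *: f + g) = c%:MP *: map_mx phi f + map_mx phi g.
Proof. by move=> h; apply/rowP => s; rewrite !mxE !mul_mpolyC h. Qed.

Lemma map_act_right phi w f : mpoly_linear phi ->
  map_mx phi (act_right rho w f) = act_right rho w (map_mx phi f).
Proof.
move=> h; have h0 := mpoly_linear0 h.
have hD p q : phi (p + q) = phi p + phi q by have := h 1 p q; rewrite !scale1r.
apply/rowP => s; rewrite !mxE (big_morph phi hD h0); apply: eq_bigr => l _.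
rewrite !mxE mulrC mul_mpolyC [RHS]mulrC mul_mpolyC.
by have := h (rho w l s) (f 0 l) 0; rewrite !addr0 h0 addr0.
Qed.

Lemma act_rightM w w' f :
  act_right rho w (act_right rho w' f) = act_right rho (w * w')%g f.
Proof. by rewrite /act_right -mulmxA -map_mxM rhoM. Qed.

Lemma act_right1 f : act_right rho 1%g f = f.
Proof. by rewrite /act_right rho1 map_mx1 mulmx1. Qed.

Lemma act_rightD w f g :
  act_right rho w (f + g) = act_right rho w f + act_right rho w g.
Proof. exact: mulmxDl. Qed.

Lemma act_rightZ w p f : act_right rho w (p *: f) = p *: act_right rho w f.
Proof. by rewrite /act_right scalemxAl. Qed.

(* The diagonal action of w, i.e. x |-> xw on polynomials and tau(w) on V. *)
Definition wact w f := act_right rho w (map_mx (msym w^-1) f).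

Lemma wact_tperm i j f :
  wact (tperm i j) f = act_right rho (tperm i j) (map_mx (msym (tperm i j)) f).
Proof. by rewrite /wact tpermV. Qed.

Lemma wactM w w' f : wact w (wact w' f) = wact (w * w')%g f.
Proof.
rewrite /wact map_act_right; last exact: msym_mpoly_linear.
rewrite act_rightM; congr act_right; apply/rowP => s; rewrite !mxE.
by rewrite -msymMm invMg.
Qed.

Lemma wact1 f : wact 1%g f = f.
Proof.
by rewrite /wact act_right1 invg1; apply/rowP => s; rewrite !mxE msym1m.
Qed.

Lemma wact_tpermK i j f : wact (tperm i j) (wact (tperm i j) f) = f.
Proof. by rewrite wactM tperm2 wact1. Qed.

Lemma wactZ w p f : wact w (p *: f) = msym w^-1 p *: wact w f.
Proof.
by rewrite /wact -act_rightZ; congr act_right; apply/rowP => s; rewrite !mxE msymM.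
Qed.

Lemma wactD w f g : wact w (f + g) = wact w f + wact w g.
Proof.
by rewrite /wact -act_rightD; congr act_right; apply/rowP => s; rewrite !mxE msymD.
Qed.

Lemma wactC w c f : wact w (c%:MP *: f) = c%:MP *: wact w f.
Proof. by rewrite wactZ -[c%:MP]mulr1 mul_mpolyC msymZ msym1. Qed.

Lemma wact0 w : wact w 0 = 0.
Proof. by have := wactC w 0 0; rewrite mpolyC0 !scale0r. Qed.

Lemma wact_sum w (I : Type) (r : seq I) (P : pred I) (E : I -> 'rV_d) :
  wact w (\sum_(l <- r | P l) E l) = \sum_(l <- r | P l) wact w (E l).
Proof. exact: (big_morph _ (wactD w) (wact0 w)). Qed.

Lemma wact_tperm_conj i j w f :
  wact (tperm i j) (wact w f) = wact w (wact (tperm (w i) (w j)) f).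
Proof. by rewrite !wactM -tpermJ /conjg mulgA mulgA mulgV mul1g. Qed.

Lemma ddiff_wact i j w f : i != j ->
  map_mx (ddiff i j) (wact w f) = wact w (map_mx (ddiff (w i) (w j)) f).
Proof.
move=> ij; apply: etrans (map_act_right w _ (ddiff_mpoly_linear ij)) _.
by congr act_right; apply/rowP => s; rewrite !mxE ddiff_msym.
Qed.

Lemma wact_act_right i j w f :
  act_right rho (tperm i j) (wact w f)
    = wact w (act_right rho (tperm (w i) (w j)) f).
Proof.
rewrite {2}/wact (map_act_right _ _ (msym_mpoly_linear w^-1)).
rewrite /wact !act_rightM -tpermJ.
by rewrite /conjg mulgA mulgA mulgV mul1g.
Qed.

Notation D := (dunkl rho kappa).
Notation U := (cherednik rho kappa).

Lemma dunkl_linear i c f g : D i (c%:MP *: f + g) = c%:MP *: D i f + D i g.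
Proof.
rewrite /dunkl map_mx_linear; last exact: mderiv_mpoly_linear.
rewrite scalerDr [RHS]addrACA; congr (_ + _).
rewrite scalerA mulrC -scalerA -scalerDr; congr (_ *: _).
rewrite scaler_sumr -big_split; apply: eq_bigr => j ji.
rewrite map_mx_linear ?act_rightD ?act_rightZ //.
by apply: ddiff_mpoly_linear; rewrite eq_sym.
Qed.

Lemma dunklD i f g : D i (f + g) = D i f + D i g.
Proof. by have := dunkl_linear i 1 f g; rewrite mpolyC1 !scale1r. Qed.

Lemma dunkl0 i : D i 0 = 0.
Proof. by apply: (addrI (D i 0)); rewrite -dunklD !addr0. Qed.

Lemma dunklC i c f : D i (c%:MP *: f) = c%:MP *: D i f.
Proof. by have := dunkl_linear i c f 0; rewrite dunkl0 !addr0. Qed.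

Lemma dunklN i f : D i (- f) = - D i f.
Proof. by apply/eqP; rewrite -addr_eq0 -dunklD addNr dunkl0. Qed.

Lemma dunkl_subC i c f g : D i (f - c%:MP *: g) = D i f - c%:MP *: D i g.
Proof. by rewrite dunklD dunklN dunklC. Qed.

Lemma dunkl_sum i (I : Type) (r : seq I) (P : pred I) (E : I -> 'rV_d) :
  D i (\sum_(l <- r | P l) E l) = \sum_(l <- r | P l) D i (E l).
Proof. exact: (big_morph _ (dunklD i) (dunkl0 i)). Qed.

Lemma mderiv_msym i w (p : {mpoly F[N]}) :
  mderiv i (msym w^-1 p) = msym w^-1 (mderiv (w i) p).
Proof.
apply/mpolyP => m; rewrite mcoeff_deriv !mcoeff_sym mcoeff_deriv mnmE permK.
congr (_@__ *+ _); apply/mnmP => l; rewrite !mnmE; congr (_ + nat_of_bool _)%N.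
by rewrite -[l in RHS](permKV w) (inj_eq perm_inj).
Qed.

Lemma dunkl_wact i w f : D i (wact w f) = wact w (D (w i) f).
Proof.
rewrite /dunkl wactD wactC wact_sum; congr (_ + _ *: _).
  rewrite map_act_right; last exact: mderiv_mpoly_linear.
  by congr act_right; apply/rowP => s; rewrite !mxE mderiv_msym.
rewrite [RHS](reindex_inj (@perm_inj _ w)) /=.
apply: eq_big => [j|j ji]; first by rewrite (inj_eq perm_inj).
have ij : i != j by rewrite eq_sym.
by apply: etrans (congr1 _ (ddiff_wact w f ij)) _; apply: wact_act_right.
Qed.

(** Multiplication by x_k commutes with the derivative in x_j and with every divided difference of
    D_j except the one for the pair (j, k), which contributes the transposition. *)
Lemma dunkl_mulX j k f : j != k ->
  D j ('X_k *: f) = 'X_k *: D j f - kappa%:MP *: wact (tperm j k) f.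
Proof.
move=> jk; rewrite /dunkl scalerDr -addrA; congr (_ + _).
  apply/rowP => s; rewrite !mxE mderivM mderivX mnm1E eq_sym (negbTE jk).
  by rewrite scale0r mul0r add0r.
rewrite scalerA [_ * kappa%:MP]mulrC -scalerA -scalerBr; congr (_ *: _).
have kj : k != j by rewrite eq_sym.
rewrite scaler_sumr (bigD1 k) //= [in RHS](bigD1 k) //= addrAC; congr (_ + _).
  rewrite -act_rightZ wact_tperm -mulNmx -act_rightD; congr act_right.
  by apply/rowP => s; rewrite !mxE ddiff_mulXr.
apply: eq_bigr => l /andP[lj lk]; rewrite -act_rightZ; congr act_right.
by apply/rowP => s; rewrite !mxE ddiff_mulXD // eq_sym.
Qed.

(* The action of the Jucys-Murphy element (i, i+1) + ... + (i, N). *)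
Definition jucys i f := \sum_(l < N | (i < l)%N) wact (tperm i l) f.

(** Moving x_i past D_i produces f and all transpositions (i l); the subtracted sum removes those
    with l < i, and a Jucys-Murphy element remains. *)
Lemma cherednikE i f :
  U i f = f + 'X_i *: D i f + kappa%:MP *: jucys i f.
Proof.
have h : D i ('X_i *: f)
    = f + 'X_i *: D i f + kappa%:MP *: \sum_(l < N | l != i) wact (tperm i l) f.
  rewrite /dunkl scalerDr addrA -[RHS]addrA; congr (_ + _).
    have UU : (U_(i) - U_(i))%MM = 0%MM :> 'X_{1..N}.
      by apply/mnmP => l; rewrite !mnmE subnn.
    by apply/rowP => s; rewrite !mxE mderivM mderivX mnm1E eqxx UU scale1r
      mpolyX0 mul1r.
  rewrite scalerA [_ * kappa%:MP]mulrC -scalerA -scalerDr; congr (_ *: _).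
  rewrite scaler_sumr -big_split; apply: eq_bigr => l li /=.
  rewrite -act_rightZ wact_tperm -act_rightD; congr act_right.
  by apply/rowP => s; rewrite !mxE ddiff_mulX // eq_sym.
rewrite /cherednik h -addrA; congr (_ + _); rewrite -scalerBr; congr (_ *: _).
rewrite (bigID (fun l : 'I_N => (l < i)%N)) /=.
rewrite [X in X + _ - _](_ : _ = \sum_(j < N | (j < i)%N)
    act_right rho (tperm i j) (map_mx (msym (tperm i j)) f)); last first.
  apply: eq_big => [l|l _]; last exact: wact_tperm.
  by rewrite -val_eqE; case: ltngtP.
rewrite addrAC subrr add0r; apply: eq_bigl => l.
by rewrite -val_eqE; case: ltngtP.
Qed.

Lemma dunkl_jucys i j f : D j (jucys i f)
  = \sum_(l < N | (i < l)%N) wact (tperm i l) (D (tperm i l j) f).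
Proof.
apply: etrans (dunkl_sum _ _ _ _) _; apply: eq_bigr => l _.
exact: dunkl_wact.
Qed.

Lemma jucys_swap i j f : j = i.+1 :> nat ->
  jucys i (wact (tperm i j) f) = f + wact (tperm i j) (jucys j f).
Proof.
move=> ji; have ij : i != j by rewrite -val_eqE /= ji; lia.
rewrite /jucys (bigD1 j) /= ?ji // wact_tpermK; congr (_ + _).
rewrite wact_sum; apply: eq_big => [l|l /andP[il lj]].
  by rewrite -val_eqE /= ji; lia.
rewrite wact_tperm_conj tpermL tpermD // 1?eq_sym //.
by rewrite neq_ltn il orbT.
Qed.

Lemma jucys_swapr i j f : j = i.+1 :> nat ->
  jucys j (wact (tperm i j) f) = wact (tperm i j) (jucys i f) - f.
Proof.
move=> ji; have := jucys_swap (wact (tperm i j) f) ji.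
by rewrite wact_tpermK => ->; rewrite wactD !wact_tpermK addrAC subrr add0r.
Qed.

Lemma jucys_swapD i j k f : j = i.+1 :> nat -> k != i -> k != j ->
  jucys k (wact (tperm i j) f) = wact (tperm i j) (jucys k f).
Proof.
move=> ji ki kj; rewrite /jucys wact_sum.
rewrite (reindex_inj (@perm_inj _ (tperm i j))); apply: eq_big => [l|l _].
  by case: tpermP => [->|->|//]; move: ki kj; rewrite -!val_eqE /= ji; lia.
by rewrite wact_tperm_conj tpermK tpermD // eq_sym.
Qed.

Lemma wact_tpermX i j k f :
  wact (tperm i j) ('X_k *: f) = 'X_(tperm i j k) *: wact (tperm i j) f.
Proof. by apply: etrans (wactZ _ _ _) _; rewrite tpermV msymX1. Qed.

Lemma wact_tperm_dunkl i j k f :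
  wact (tperm i j) ('X_k *: D k f)
    = 'X_(tperm i j k) *: D (tperm i j k) (wact (tperm i j) f).
Proof. by rewrite wact_tpermX dunkl_wact tpermK. Qed.

Lemma cherednik_first i f : i = 0%N :> nat -> U i f = D i ('X_i *: f).
Proof.
by move=> i0; rewrite /cherednik big_pred0 ?scaler0 ?subr0 // => l; rewrite i0.
Qed.

(** With the next two lemmas, the relations of the graded affine Hecke algebra. The operators x_k
    D_k are merely permuted, so the extra term comes from the Jucys-Murphy part. *)
Lemma cherednik_swap i j f : j = i.+1 :> nat ->
  U i (wact (tperm i j) f) = wact (tperm i j) (U j f) + kappa%:MP *: f.
Proof.
move=> ji; rewrite !cherednikE !wactD wactC wact_tperm_dunkl tpermR.
by rewrite jucys_swap // [kappa%:MP *: (_ + _)]scalerDr [LHS]addrA [LHS]addrAC.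
Qed.

Lemma cherednik_swapr i j f : j = i.+1 :> nat ->
  U j (wact (tperm i j) f) = wact (tperm i j) (U i f) - kappa%:MP *: f.
Proof.
move=> ji; rewrite !cherednikE !wactD wactC wact_tperm_dunkl tpermL.
by rewrite jucys_swapr // scalerBr addrA.
Qed.

Lemma cherednik_swapD i j k f : j = i.+1 :> nat -> k != i -> k != j ->
  U k (wact (tperm i j) f) = wact (tperm i j) (U k f).
Proof.
move=> ji ki kj; have tk : tperm i j k = k by rewrite tpermD // eq_sym.
by rewrite !cherednikE !wactD wactC wact_tperm_dunkl tk jucys_swapD.
Qed.

Lemma cherednik_linear i c f g : U i (c%:MP *: f + g) = c%:MP *: U i f + U i g.
Proof.
have jl : jucys i (c%:MP *: f + g) = c%:MP *: jucys i f + jucys i g.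
  rewrite /jucys scaler_sumr -big_split; apply: eq_bigr => l _.
  by rewrite wactD wactC.
by rewrite !cherednikE dunkl_linear jl; apply: scaler_comb3.
Qed.

End OperatorAlgebra.

(** * A weight on exponents, and the order given by ranks *)

Section MonomialWeight.
Variable N : nat.
Implicit Types (a b : 'X_{1..N}) (i j l : 'I_N).

Definition mswap i j b : 'X_{1..N} := [multinom b (tperm i j l) | l < N].

(* Refines the dominance order: it grows when exponents are spread apart, and
   when a larger exponent is moved to an earlier variable. *)
Definition mweight b : int :=
  \sum_(l < N) (N%:Z * (b l)%:Z * (b l)%:Z - l%:Z * (b l)%:Z).

Lemma mweight_pair i j a b : i != j ->
    (forall l, l != i -> l != j -> a l = b l) -> (a i + a j = b i + b j)%N ->
  let d := (a i)%:Z - (b i)%:Z in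
  mweight a - mweight b
    = d * (N%:Z * ((a i)%:Z + (b i)%:Z - (a j)%:Z - (b j)%:Z) - i%:Z + j%:Z).
Proof.
move=> ij h hs d; have ji : j != i by rewrite eq_sym.
rewrite /mweight (bigD1 i) //= (bigD1 j) //= [X in _ - X](bigD1 i) //=.
rewrite [X in _ - (_ + X)](bigD1 j) //=.
rewrite (eq_bigr (fun l : 'I_N => N%:Z * (b l)%:Z * (b l)%:Z - l%:Z * (b l)%:Z)).
  have -> : (a j)%:Z = (b j)%:Z - d by rewrite /d; lia.
  have -> : (a i)%:Z = (b i)%:Z + d by rewrite /d; lia.
  ring.
by move=> l /andP[li lj]; rewrite h.
Qed.

(** The factor N makes the quadratic part win: in [mweight_pair] it contributes at least 2N in
    absolute value, with the sign of d, against a difference of positions smaller than N. *)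
Lemma mweight_spread i j a b : i != j ->
    (forall l, l != i -> l != j -> a l = b l) -> (a i + a j = b i + b j)%N ->
    (maxn (b i) (b j) < maxn (a i) (a j))%N ->
  mweight b < mweight a.
Proof.
move=> ij h hs hm; rewrite -subr_gt0 (mweight_pair ij h hs).
have iN := ltn_ord i; have jN := ltn_ord j.
have [ai|aj] : (maxn (b i) (b j) < a i \/ maxn (b i) (b j) < a j)%N by lia.
  apply: mulr_gt0; first lia.
  have : N%:Z * 2 <= N%:Z * ((a i)%:Z + (b i)%:Z - (a j)%:Z - (b j)%:Z).
    by apply: ler_wpM2l; lia.
  lia.
rewrite -mulrNN; apply: mulr_gt0; first lia.
have : N%:Z * 2 <= N%:Z * ((a j)%:Z + (b j)%:Z - (a i)%:Z - (b i)%:Z).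
  by apply: ler_wpM2l; lia.
lia.
Qed.

Lemma mweight_mswap i j b : (i < j)%N -> (b i < b j)%N ->
  mweight b < mweight (mswap i j b).
Proof.
move=> ij hb; have ne : i != j by rewrite neq_ltn ij.
have ei : mswap i j b i = b j by rewrite mnmE tpermL.
have ej : mswap i j b j = b i by rewrite mnmE tpermR.
rewrite -subr_gt0 (@mweight_pair i j) //; first last.
- by rewrite ei ej addnC.
- by move=> l li lj; rewrite mnmE tpermD // eq_sym.
rewrite ei ej; apply: mulr_gt0; first lia.
by rewrite (_ : _ - _ - _ = 0) ?mulr0; lia.
Qed.

Lemma mswapC i j b : mswap i j b = mswap j i b.
Proof. by rewrite /mswap tpermC. Qed.

Lemma mswap_id i j b : b i = b j -> mswap i j b = b.
Proof. by move=> h; apply/mnmP => l; rewrite mnmE; case: tpermP => [->|->|]. Qed.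

(** The order numbered by the rank function: larger exponents first, ties broken by position. *)
Definition rank_before b i j : bool := (b j < b i)%N || (b i == b j) && (i < j)%N.

Lemma rank_beforeP b i j : rank_before b i j = (rank_perm b i < rank_perm b j)%N.
Proof.
have L i' j' : rank_before b i' j' -> (rank_perm b i' < rank_perm b j')%N.
  rewrite /rank_before => hij; rewrite /rank_perm !permE /= !rank_natE /=.
  apply: proper_card; apply/properP; split.
    apply/subsetP => k; rewrite !inE; move: hij.
    case: (ltngtP (b i') (b j')) => //= [h _|->].
    - by case/orP => [/(ltn_trans h) -> //|/andP[/eqP <- _]]; rewrite h.
    - by move=> ij /orP[->//|/andP[-> h]]; rewrite (ltn_trans h ij) orbT.
  by exists i'; rewrite !inE ?ltnn ?andbF // [b j' == _]eq_sym.
apply/idP/idP; first exact: L.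
have [<-|ij] := eqVneq i j; first by rewrite ltnn.
apply: contraTT => hn; rewrite -leqNgt ltnW // L //.
move: hn ij; rewrite /rank_before -val_eqE /=.
by case: (ltngtP (b i) (b j)); case: (ltngtP i j).
Qed.

End MonomialWeight.

Lemma exists_int_max (T : eqType) (s : seq T) (W : T -> int) : s != [::] ->
  exists2 x, x \in s & forall y, y \in s -> W y <= W x.
Proof.
elim: s => // a [|b s] IH _; first by exists a => [|y]; rewrite inE // => /eqP ->.
have [x xs hx] := IH isT.
have [h|h] := lerP (W a) (W x).
  exists x => [|y]; first by rewrite inE xs orbT.
  by rewrite inE => /orP[/eqP ->|/hx].
exists a => [|y]; first by rewrite inE eqxx.
by rewrite inE => /orP[/eqP -> //|/hx /le_trans -> //]; apply: ltW.
Qed.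

(** * Vector coefficients of monomials and the action on a coefficient of maximal weight *)

Section Coefficients.
Variables (F : fieldType) (N d : nat) (rho : 'S_N -> 'M[F]_d) (kappa : F).
Hypothesis rho1 : rho 1%g = 1%:M.
Hypothesis rhoM : forall w1 w2 : 'S_N, rho (w2 * w1)%g = rho w1 *m rho w2.
Implicit Types (f g : 'rV[{mpoly F[N]}]_d) (w : 'S_N) (i j k l : 'I_N).
Implicit Types (b : 'X_{1..N}).
Local Opaque ddiff msym mderiv.

Notation D := (dunkl rho kappa).
Notation U := (cherednik rho kappa).

Definition vcoeff b f : 'rV[F]_d := map_mx (mcoeff b) f.

Lemma vcoeffP f g : (forall b, vcoeff b f = vcoeff b g) <-> f = g.
Proof.
split=> [h|-> //]; apply/rowP => s; apply/mpolyP => b.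
by have := congr1 (fun v : 'rV_d => v 0 s) (h b); rewrite !mxE.
Qed.

Lemma vcoeffD b f g : vcoeff b (f + g) = vcoeff b f + vcoeff b g.
Proof. by apply/rowP => s; rewrite !mxE mcoeffD. Qed.

Lemma vcoeff0 b : vcoeff b 0 = 0.
Proof. by apply/rowP => s; rewrite !mxE mcoeff0. Qed.

Lemma vcoeffC b c f : vcoeff b (c%:MP *: f) = c *: vcoeff b f.
Proof. by apply/rowP => s; rewrite !mxE mul_mpolyC mcoeffZ. Qed.

Lemma vcoeffN b f : vcoeff b (- f) = - vcoeff b f.
Proof. by apply/rowP => s; rewrite !mxE mcoeffN. Qed.

Lemma vcoeff_sum b (I : Type) (r : seq I) (P : pred I) (E : I -> 'rV_d) :
  vcoeff b (\sum_(l <- r | P l) E l) = \sum_(l <- r | P l) vcoeff b (E l).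
Proof. exact: (big_morph _ (vcoeffD b) (vcoeff0 b)). Qed.

Lemma vcoeff_act_right b w f :
  vcoeff b (act_right rho w f) = vcoeff b f *m rho w.
Proof.
apply/rowP => s; rewrite !mxE raddf_sum; apply: eq_bigr => l _ /=.
by rewrite !mxE mulrC mul_mpolyC mcoeffZ mulrC.
Qed.

Lemma vcoeff_wact_tperm b i j f :
  vcoeff b (wact rho (tperm i j) f) = vcoeff (mswap i j b) f *m rho (tperm i j).
Proof.
rewrite /wact vcoeff_act_right tpermV; congr (_ *m _).
by apply/rowP => s; rewrite !mxE mcoeff_sym.
Qed.

Lemma vcoeff_jucys b i f : vcoeff b (jucys rho i f)
  = \sum_(l < N | (i < l)%N) vcoeff (mswap i l b) f *m rho (tperm i l).
Proof.
by rewrite vcoeff_sum; apply: eq_bigr => l _; rewrite vcoeff_wact_tperm.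
Qed.

Lemma vcoeff_mulX b i f : vcoeff (b + U_(i))%MM ('X_i *: f) = vcoeff b f.
Proof. by apply/rowP => s; rewrite !mxE mulrC addmC mcoeffMX. Qed.

Lemma vcoeff_mulX0 b i f : b i = 0%N -> vcoeff b ('X_i *: f) = 0.
Proof. by move=> h; apply/rowP => s; rewrite !mxE mulrC mcoeffMX_eq0. Qed.

Lemma mshiftE i j l b (k1 k2 : nat) :
  (b + U_(i) *+ k1 - U_(j) *+ k2)%MM l = (b l + (i == l) * k1 - (j == l) * k2)%N.
Proof. by rewrite mnmBE mnmDE !mulmnE !mnm1E. Qed.

Lemma mulX_inj i f : 'X_i *: f = 0 -> f = 0.
Proof.
move=> h; apply/vcoeffP => b.
by rewrite -(vcoeff_mulX b i) h !vcoeff0.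
Qed.

Lemma vcoeff_ddiff i j b f : i != j -> vcoeff b (map_mx (ddiff i j) f) =
  \sum_(k < (b j).+1)
     (vcoeff (b + U_(i) *+ k.+1 - U_(j) *+ k)%MM f
      - vcoeff (mswap i j (b + U_(i) *+ k.+1 - U_(j) *+ k)%MM) f).
Proof.
move=> ij; apply/rowP => s; rewrite !mxE mcoeff_ddiff // summxE.
by apply: eq_bigr => k _; rewrite !mxE mcoeffB mcoeff_sym.
Qed.

Lemma vcoeff_dunkl b i f : vcoeff b (D i f) =
  vcoeff (b + U_(i))%MM f *+ (b i).+1
  + kappa *: \sum_(j < N | j != i)
      vcoeff b (map_mx (ddiff i j) f) *m rho (tperm i j).
Proof.
rewrite /dunkl vcoeffD vcoeffC vcoeff_sum; congr (_ + _ *: _).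
  by apply/rowP => s; rewrite mulmxnE !mxE mcoeff_deriv.
by apply: eq_bigr => j _; rewrite vcoeff_act_right.
Qed.

Definition homogeneous_deg (n : nat) f : Prop :=
  forall b, mdeg b != n -> vcoeff b f = 0.

Lemma mdeg_mswap i j b : mdeg (mswap i j b) = mdeg b.
Proof. exact: mdeg_mperm. Qed.

Lemma homogeneous_dunkl n i f :
  homogeneous_deg n.+1 f -> homogeneous_deg n (D i f).
Proof.
move=> hf b bn; rewrite vcoeff_dunkl hf; last by rewrite mdegD mdeg1 addn1 eqSS.
rewrite mul0rn add0r big1 ?scaler0 // => j ji.
rewrite vcoeff_ddiff 1?eq_sym // big1 ?mul0mx // => k _.
have h : mdeg (b + U_(i) *+ k.+1 - U_(j) *+ k)%MM != n.+1.
  have e : (b + U_(i) *+ k.+1 - U_(j) *+ k + U_(j) *+ k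
      = b + U_(i) *+ k.+1)%MM.
    apply/mnmP => l; rewrite mnmDE mshiftE mnmDE !mulmnE !mnm1E; have := ltn_ord k.
    by have [<-|_] := eqVneq j l; case: (i == _); lia.
  have := congr1 mdeg e; rewrite !mdegD !mdegMn !mdeg1; lia.
by rewrite !hf ?mdeg_mswap // subr0.
Qed.

Lemma vcoeff_support f : exists s : seq 'X_{1..N},
  forall b, vcoeff b f != 0 -> b \in s.
Proof.
exists (flatten [seq msupp (f 0 s) | s : 'I_d]) => b h.
have [s hs] : exists s : 'I_d, vcoeff b f 0 s != 0.
  apply/existsP; apply: contraNT h; rewrite negb_exists => /forallP h.
  by apply/eqP/rowP => s; have := h s; rewrite negbK mxE [RHS]mxE => /eqP.
apply/flatten_mapP; exists s; first by rewrite mem_enum.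
by rewrite mcoeff_msupp; rewrite mxE in hs.
Qed.

Lemma exists_max_weight f : f <> 0 -> exists b, vcoeff b f != 0 /\
  forall a, vcoeff a f != 0 -> mweight a <= mweight b.
Proof.
move=> f0; have [s hs] := vcoeff_support f.
have [|b] := @exists_int_max _ [seq b <- s | vcoeff b f != 0] (@mweight N).
  apply/negP => /eqP h; apply: f0; apply/vcoeffP => b; rewrite vcoeff0.
  apply/eqP; apply: contraT => hb.
  suff : b \in [seq b <- s | vcoeff b f != 0] by rewrite h.
  by rewrite mem_filter hb hs.
rewrite mem_filter => /andP[hb _] h; exists b; split=> // a ha; apply: h.
by rewrite mem_filter ha hs.
Qed.

Definition is_max_weight b f : Prop :=
  forall a, mweight b < mweight a -> vcoeff a f = 0.

(** In the expansion of [vcoeff_ddiff] the terms with k > 0 involve exponents spread wider at [i]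
    and [j] than in b, hence of larger weight, where f has coefficient zero. *)
Lemma vcoeff_ddiff_max i j b f : i != j -> is_max_weight b f -> (0 < b i)%N ->
  vcoeff (b - U_(i))%MM (map_mx (ddiff i j) f)
    = if (b j < b i)%N then vcoeff b f - vcoeff (mswap i j b) f else 0.
Proof.
move=> ij hb bi; have ji : j != i by rewrite eq_sym.
case: ifP => [bji|/negbT]; last rewrite -leqNgt => bij.
  have bj : (b - U_(i))%MM j = b j by rewrite mnmBE mnm1E (negbTE ij) subn0.
  rewrite vcoeff_ddiff // bj big_ord_recl big1 ?addr0 => [|k _].
    have -> // : (b - U_(i) + U_(i) *+ 1 - U_(j) *+ 0)%MM = b.
    by apply/mnmP => l; rewrite mshiftE mnmBE mnm1E; have [<-|] := eqVneq i l; lia.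
  set a := (_ - _)%MM.
  have ai : a i = (b i + k.+1)%N.
    by rewrite /a mshiftE !lift0 mnmBE mnm1E eqxx (negbTE ji); lia.
  have aj : a j = (b j - k.+1)%N.
    by rewrite /a mshiftE !lift0 mnmBE mnm1E eqxx (negbTE ij); lia.
  have kb := ltn_ord k.
  have al l : l != i -> l != j -> a l = b l.
    move=> li lj; rewrite /a mshiftE mnmBE mnm1E ![_ == l]eq_sym.
    by rewrite (negbTE li) (negbTE lj); lia.
  clearbody a; rewrite !hb ?subr0 //; apply: (mweight_spread ij).
  - by move=> l li lj; rewrite mnmE tpermD ?al // eq_sym.
  - by rewrite !mnmE tpermL tpermR ai aj; lia.
  - by rewrite !mnmE tpermL tpermR ai aj; lia.
  - exact: al.
  - by rewrite ai aj; lia.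
  - by rewrite ai aj; lia.
(* When b_i is at most b_j, the symmetry of the divided difference allows exchanging the two
   exponents first; then every term, including k = 0, is spread wider than b. *)
have -> : vcoeff (b - U_(i))%MM (map_mx (ddiff i j) f)
    = vcoeff (mswap i j (b - U_(i))%MM) (map_mx (ddiff i j) f).
  by apply/rowP => s; rewrite !mxE -mcoeff_sym ddiff_sym.
have mj : mswap i j (b - U_(i))%MM j = (b i).-1.
  by rewrite mnmE tpermR mnmBE mnm1E eqxx subn1.
rewrite vcoeff_ddiff // mj big1 // => k _.
set a := (_ - _)%MM.
have kb : (k < b i)%N by have := ltn_ord k; lia.
have ai : a i = (b j + k.+1)%N.
  rewrite /a mshiftE mnmE tpermL mnmBE mnm1E eqxx (negbTE ji) (negbTE ij); lia.
have aj : a j = (b i - k.+1)%N.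
  rewrite /a mshiftE mnmE tpermR mnmBE mnm1E !eqxx (negbTE ij); lia.
have al l : l != i -> l != j -> a l = b l.
  move=> li lj; rewrite /a mshiftE mnmE tpermD 1?eq_sym // mnmBE mnm1E.
  rewrite ![_ == l]eq_sym.
  by rewrite (negbTE li) (negbTE lj); lia.
clearbody a; rewrite !hb ?subr0 //; apply: (mweight_spread ij).
- by move=> l li lj; rewrite mnmE tpermD ?al // eq_sym.
- by rewrite !mnmE tpermL tpermR ai aj; lia.
- by rewrite !mnmE tpermL tpermR ai aj; lia.
- exact: al.
- by rewrite ai aj; lia.
- by rewrite ai aj; lia.
Qed.

(** A coefficient at a transposed exponent cancels between x_i D_i and the Jucys-Murphy part, or
    belongs to a heavier monomial, or, for b_i = b_j, is the coefficient at b itself. What survives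
    is one transposition for each index ranked after [i]. *)
Lemma vcoeff_cherednik_max i b f : is_max_weight b f ->
  vcoeff b (U i f) = (b i).+1%:R *: vcoeff b f
    + kappa *: \sum_(j < N | rank_before b i j) vcoeff b f *m rho (tperm i j).
Proof.
move=> hb; rewrite cherednikE !vcoeffD vcoeffC vcoeff_jucys.
have -> : vcoeff b ('X_i *: D i f) = (b i)%:R *: vcoeff b f
    + kappa *: \sum_(j < N | j != i) (if (b j < b i)%N
         then vcoeff b f - vcoeff (mswap i j b) f else 0) *m rho (tperm i j).
  have [bi|bi] := posnP (b i).
    rewrite vcoeff_mulX0 // bi scale0r add0r big1 ?scaler0 // => j _.
    by rewrite ltn0 mul0mx.
  have bE : b = (b - U_(i) + U_(i))%MM.
    by apply/mnmP => l; rewrite !mnmE; have [<-|] := eqVneq i l; lia.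
  rewrite {1}bE vcoeff_mulX vcoeff_dunkl -bE -scaler_nat; congr (_ *: _ + _ *: _).
    by rewrite mnmBE mnm1E eqxx; congr (_%:R); lia.
  by apply: eq_bigr => j ji; rewrite vcoeff_ddiff_max // eq_sym.
rewrite -addrA -addrA -scalerDr addrA; congr (_ + _ *: _).
  by rewrite -[X in X + _]scale1r -scalerDl addrC -natr1.
rewrite big_mkcond [X in _ + X]big_mkcond [RHS]big_mkcond -big_split.
apply: eq_bigr => j _ /=; rewrite /rank_before eq_sym.
have [->|ij] := eqVneq i j; first by rewrite !ltnn andbF addr0.
have hswap : (b i < b j)%N -> (i < j)%N -> vcoeff (mswap i j b) f = 0.
  by move=> h1 h2; apply/hb/mweight_mswap.
have hswap' : (b j < b i)%N -> (j < i)%N -> vcoeff (mswap i j b) f = 0.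
  by move=> h1 h2; rewrite mswapC; apply/hb/mweight_mswap.
have : (i < j)%N || (j < i)%N by rewrite -neq_ltn.
case: (ltngtP (b i) (b j)) hswap hswap' => [h|h|h] hs hs';
  case: (ltngtP i j) hs hs' => // hij hs hs' _; rewrite ?mul0mx ?addr0 ?add0r //=.
- by rewrite hs ?mul0mx.
- by rewrite mulmxBl subrK.
- by rewrite hs' // subr0.
- by rewrite mswap_id.
Qed.

End Coefficients.

Lemma scaler_cancel (R : pzRingType) (V : lmodType R) (a b : R) (x y z t : V) :
  x - b *: y = a *: z - b *: t -> z = 0 -> t = y -> x = 0.
Proof. by move=> h z0 ty; move: h; rewrite z0 ty scaler0 => /addIr. Qed.

Lemma sum_eq_single (V : nmodType) (I : finType) (P : pred I) (G : I -> V) j :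
  P j -> (forall l, P l -> l != j -> G l = 0) -> \sum_(l | P l) G l = G j.
Proof.
move=> Pj h; rewrite (bigD1 j) //= big1 ?addr0 // => l /andP[Pl lj].
exact: h.
Qed.

Lemma addr_scale0 (R : pzRingType) (V : lmodType R) (a : R) (x y z : V) :
  z = 0 -> x + a *: z + y = x + y.
Proof. by move=> ->; rewrite scaler0 addr0. Qed.

(** * Joint eigenfunctions of the Cherednik operators *)

Section Spectrum.
Variables (F : fieldType) (N d : nat) (rho : 'S_N -> 'M[F]_d) (kappa : F).
Hypothesis rho1 : rho 1%g = 1%:M.
Hypothesis rhoM : forall w1 w2 : 'S_N, rho (w2 * w1)%g = rho w1 *m rho w2.
Variable c : 'I_d -> 'I_N -> int.
Hypothesis hJM : forall s (i : 'I_N),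
  delta_mx 0 s *m (\sum_(l < N | (i < l)%N) rho (tperm i l))
    = (c s i)%:~R *: (delta_mx 0 s : 'rV[F]_d).
Implicit Types (f g : 'rV[{mpoly F[N]}]_d) (w : 'S_N) (i j k l : 'I_N).
Implicit Types (b : 'X_{1..N}) (E : 'I_N -> int) (m : nat).
Local Opaque ddiff msym mderiv dunkl cherednik wact jucys.

Notation D := (dunkl rho kappa).
Notation U := (cherednik rho kappa).
Local Notation wa := (wact rho).

Definition eigenfun (z : 'I_N -> F) f : Prop :=
  forall i, U i f = (z i)%:MP *: f.

(** The Jucys-Murphy matrices are diagonal in the tableau basis, so any nonzero coordinate of an
    eigenvector reveals the eigenvalue. *)
Lemma jucys_murphy_eigenvalue (u : 'rV[F]_d) i (a : F) s :
  u *m (\sum_(l < N | (i < l)%N) rho (tperm i l)) = a *: u ->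
  u 0 s != 0 -> a = (c s i)%:~R.
Proof.
move=> /(congr1 (fun v : 'rV_d => v 0 s)) h us; apply: (mulIf us).
have {h}: (u *m \sum_(l < N | (i < l)%N) rho (tperm i l)) 0 s = a * u 0 s.
  by rewrite h mxE.
move=> <-; set A := \sum_(l < N | _) _.
have hA t : A t s = (c t i)%:~R * (s == t)%:R.
  have := congr1 (fun v : 'rV_d => v 0 s) (hJM t i).
  by rewrite -rowE !mxE eqxx /=.
rewrite mxE (bigD1 s) //= big1 ?addr0 ?hA ?eqxx ?mulr1 1?mulrC //.
by move=> t ts; rewrite hA eq_sym (negbTE ts) !mulr0.
Qed.

Lemma sum_rank_before (v : 'rV[F]_d) b i :
  \sum_(j < N | rank_before b i j) v *m rho (tperm i j)
  = v *m rho (rank_perm b)^-1%g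
     *m (\sum_(l < N | (rank_perm b i < l)%N) rho (tperm (rank_perm b i) l))
     *m rho (rank_perm b).
Proof.
set w := rank_perm b; rewrite mulmx_sumr mulmx_suml.
rewrite [RHS](reindex_inj (@perm_inj _ w)) /=.
apply: eq_big => [j|j _]; first by rewrite rank_beforeP.
rewrite -!mulmxA; congr (_ *m _); rewrite -!rhoM -tpermJ /conjg; congr rho.
by rewrite !mulgA mulgV mul1g -mulgA mulgV mulg1.
Qed.

Lemma eigenfun_top z f : eigenfun z f -> f <> 0 -> exists b s,
  [/\ vcoeff b f != 0,
      forall a, vcoeff a f != 0 -> mweight a <= mweight b
    & forall i, z i = (b i).+1%:R + kappa * (c s (rank_perm b i))%:~R].
Proof.
move=> hz f0; have [b [hb hmax]] := exists_max_weight f0.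
have bmax : is_max_weight b f.
  by move=> a ab; apply/eqP; apply: contraTT ab => /hmax; rewrite -leNgt.
set v := vcoeff b f in hb; set w := rank_perm b.
(* Undoing the rank permutation turns the sums over lower-ranked indices into Jucys-Murphy elements.
   A coordinate [s] with [u 0 s] nonzero is fixed before [i], so the same tableau serves all [i]. *)
pose u := v *m rho w^-1%g.
have uw : u *m rho w = v by rewrite -mulmxA -rhoM mulgV rho1 mulmx1.
have [s us] : exists s : 'I_d, u 0 s != 0.
  apply/existsP; apply: contraNT hb; rewrite negb_exists => /forallP h.
  suff u0 : u = 0 by rewrite -uw u0 mul0mx.
  by apply/rowP => s; have := h s; rewrite negbK [RHS]mxE => /eqP.
exists b, s; split=> // i.
have := congr1 (vcoeff b) (hz i).
rewrite (vcoeff_cherednik_max rho kappa i bmax) vcoeffC -/v sum_rank_before -/w -/u.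
set A := \sum_(l < N | _) _ => h.
have hA : u *m (kappa *: A) = (z i - (b i).+1%:R) *: u.
  have -> : u = v *m rho w^-1%g by [].
  rewrite scalemxAl scalerBl -h addrAC subrr add0r -scalemxAl -/u.
  by rewrite -mulmxA -rhoM mulVg rho1 mulmx1 -scalemxAr.
(* For kappa = 0 the eigenvalue is the exponent plus 1 alone; otherwise division by kappa isolates
   the Jucys-Murphy eigenvalue. *)
have [k0|k0] := eqVneq kappa 0.
  move: hA; rewrite k0 scale0r mulmx0 mul0r addr0.
  have u0 : u != 0 by apply: contraNneq us => ->; rewrite mxE.
  move=> /esym/eqP.
  by rewrite scaler_eq0 (negbTE u0) orbF subr_eq0 => /eqP.
have hA' : u *m A = (kappa^-1 * (z i - (b i).+1%:R)) *: u.
  by rewrite -scalerA -hA -scalemxAr scalerA mulVf // scale1r.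
rewrite -(jucys_murphy_eigenvalue hA' us) mulrA divff // mul1r.
by rewrite addrC subrK.
Qed.

(** The multiple of f subtracted is chosen to absorb the terms kappa f and -kappa f of the Hecke
    relations; at the other indices there is nothing to absorb. *)
Lemma eigenfun_step z f i j : j = i.+1 :> nat -> z i != z j -> eigenfun z f ->
  eigenfun (z \o tperm i j)
    (wa (tperm i j) f - (kappa / (z i - z j))%:MP *: f).
Proof.
move=> ji zij hz k; have dz : z i - z j != 0 by rewrite subr_eq0.
set t := kappa / _; set s := tperm i j.
have tE : t * (z i - z j) = kappa by rewrite /t mulfVK.
have lin : U k (wa s f - t%:MP *: f) = U k (wa s f) - (t * z k)%:MP *: f.
  rewrite addrC -scaleNr -mpolyCN cherednik_linear hz scalerA -mpolyCM mulNr mpolyCN.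
  by rewrite scaleNr addrC.
have fin (a : F) : U k (wa s f) = a%:MP *: wa s f + (t * (z k - a))%:MP *: f ->
    U k (wa s f - t%:MP *: f) = a%:MP *: (wa s f - t%:MP *: f).
  move=> h; rewrite lin h scalerBr scalerA -mpolyCM -addrA -scalerBl -mpolyCB.
  by rewrite -mulrBr [_ - _ - _]addrAC subrr add0r mulrN mpolyCN scaleNr [t * a]mulrC.
rewrite /=; apply: fin; have ij : i != j by rewrite -val_eqE /= ji; lia.
have [->|ki] := eqVneq k i.
  by rewrite tpermL (cherednik_swap kappa rho1 rhoM f ji) hz wactC tE.
have [->|kj] := eqVneq k j.
  have tE' : t * (z j - z i) = - kappa by rewrite -opprB mulrN tE.
  rewrite tpermR tE' (cherednik_swapr kappa rho1 rhoM f ji) hz wactC.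
  by rewrite mpolyCN scaleNr.
rewrite /s (cherednik_swapD kappa rhoM f ji ki kj) hz wactC tpermD 1?eq_sym //.
by rewrite subrr mulr0 mpolyC0 scale0r addr0.
Qed.

(** The eigenvalues that belong to the leading monomial x_i^m. [E k] is the content at the rank of
    [k], so that exchanging variables only composes [E] with a transposition. *)
Definition peak_spectrum m i E k : F :=
  ((k == i) * m).+1%:R + kappa * (E k)%:~R.

Lemma peak_spectrum_perm m i E w k :
  peak_spectrum m (w i) E (w k) = peak_spectrum m i (E \o w) k.
Proof. by rewrite /peak_spectrum (inj_eq perm_inj). Qed.

(* With X = c_1 + m / kappa one has x_1 (f D_1) = kappa (X f - f w_1), where w_1
   is the Jucys-Murphy element; this gives the action of the operators on f D_1
   without using that the Dunkl operators commute. *)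
Lemma eigenfun_dunkl_first m E f (one : 'I_N) : one = 0%N :> nat ->
    eigenfun (peak_spectrum m.+1 one E) f ->
    (forall j, j != one -> D j f = 0) ->
  (forall j, j != one -> D j (D one f) = 0)
  /\ eigenfun (peak_spectrum m one E) (D one f).
Proof.
move=> one0 hf hD; move eg : (D one f) => g.
have Xg : 'X_one *: g = (m.+1%:R + kappa * (E one)%:~R)%:MP *: f
    - kappa%:MP *: jucys rho one f.
  have := hf one; rewrite cherednikE eg /peak_spectrum eqxx mul1n -natr1.
  rewrite [_ + 1 + _]addrAC mpolyCD scalerDl mpolyC1 scale1r => h.
  by apply: (addrI f); rewrite [RHS]addrA [f + _%:MP *: f]addrC -h addrK.
have one_lt j : (one < j)%N = (j != one) by rewrite -val_eqE /= one0 lt0n.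
have comb i (a b : F) f1 f2 : D i (a%:MP *: f1 - b%:MP *: f2)
    = a%:MP *: D i f1 - b%:MP *: D i f2.
  by rewrite dunkl_linear dunklN dunklC.
have Dj j : j != one -> D j g = 0.
  move=> j1; have hJ : D j (jucys rho one f) = wa (tperm j one) g.
    apply: etrans (dunkl_jucys kappa rhoM one j f) _.
    apply: etrans (sum_eq_single (j := j) _ _) _; first by rewrite one_lt.
      move=> l l1 lj.
      have tl : tperm one l j = j by rewrite tpermD // eq_sym.
      have e : D (tperm one l j) f = 0 by rewrite tl; apply: hD.
      exact: etrans (congr1 (wa _) e) (wact0 _ _).
    rewrite tpermR.
    rewrite eg.
    by rewrite tpermC.
  (* Applying D_j to the formula for x_1 g and moving it past x_1 gives the same term kappa times (1
     j) g on both sides, so x_1 times D_j g is zero. *)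
  exact: mulX_inj (scaler_cancel (etrans (esym (dunkl_mulX rho kappa g j1))
    (etrans (congr1 (D j) Xg) (comb _ _ _ _ _))) (hD j j1) hJ).
split; first exact: Dj.
move=> j; have [->|j1] := eqVneq j one.
  have hJ : D one (jucys rho one f) = 0.
    apply: etrans (dunkl_jucys kappa rhoM one one f) _; apply: big1 => l l1.
    have ol : l != one by rewrite -one_lt.
    by rewrite tpermL hD ?wact0.
  apply: etrans (cherednik_first rho kappa g one0) _.
  apply: etrans (congr1 (D one) Xg) _; apply: etrans (comb _ _ _ _ _) _.
  by rewrite hJ eg scaler0 subr0 /peak_spectrum eqxx mul1n.
have zE : peak_spectrum m one E j = peak_spectrum m.+1 one E j.
  by rewrite /peak_spectrum (negbTE j1) !mul0n.
(* The transpositions (j l) with l > j fix the first index, hence commute with D_1. *)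
have hJ : jucys rho j g = D one (jucys rho j f).
  apply: etrans _ (esym (dunkl_jucys kappa rhoM j one f)).
  apply: eq_bigr => l jl; have lo : l != one by rewrite -val_eqE /= one0; lia.
  by rewrite tpermD ?eg.
have U0 h0 : D j h0 = 0 -> U j h0 = h0 + kappa%:MP *: jucys rho j h0.
  exact: (fun h => etrans (cherednikE _ _ _ _) (addr_scale0 _ _ _ h)).
rewrite zE; apply: etrans (U0 g (Dj j j1)) _; rewrite hJ -eg.
apply: etrans (congr1 (+%R _) (esym (dunklC rho kappa one _ _))) _.
apply: etrans (esym (dunklD rho kappa one _ _)) _.
apply: etrans (congr1 (D one) (esym (U0 f (hD j j1)))) _.
exact: etrans (congr1 (D one) (hf j)) (dunklC _ _ _ _ _).
Qed.

End Spectrum.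

(** * Powers of a single variable *)

Section PeakMonomials.
Variable N : nat.
Implicit Types (i j k : 'I_N).

Definition peak_mnm i m : 'X_{1..N} := (U_(i) *+ m)%MM.

Lemma peak_mnmE i m k : peak_mnm i m k = ((k == i) * m)%N.
Proof. by rewrite mulmnE mnm1E eq_sym. Qed.

Lemma peak_mnmS i m : peak_mnm i m.+1 = (peak_mnm i m + U_(i))%MM.
Proof. by rewrite /peak_mnm mulmSr. Qed.

Lemma mdeg_peak_mnm i m : mdeg (peak_mnm i m) = m.
Proof. by rewrite mdegMn mdeg1 mul1n. Qed.

Lemma mswap_peak_mnm i j m : mswap i j (peak_mnm j m) = peak_mnm i m.
Proof.
apply/mnmP => k; rewrite mnmE !peak_mnmE; congr (nat_of_bool _ * _)%N.
by rewrite -[X in _ == X](tpermL i j) (inj_eq perm_inj).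
Qed.

Lemma rank_perm_peak_first (one : 'I_N) m : one = 0%N :> nat ->
  rank_perm (peak_mnm one m) = 1%g.
Proof.
move=> one0; apply/permP => i; rewrite perm1 permE; apply: val_inj => /=.
rewrite rank_natE /=.
rewrite (eq_card (B := [pred j : 'I_N | (j < i)%N])) => [|j].
  rewrite -sum1_card -(big_ord_widen N (fun=> 1%N)) ?sum1_card ?card_ord //.
  exact: ltnW.
rewrite !inE !peak_mnmE -!val_eqE /= one0.
by case: (nat_of_ord i) (nat_of_ord j) => [|a] [|a']; rewrite ?mul1n ?mul0n; lia.
Qed.

(** The index [k] carries the only positive exponent and takes the first rank; among the zero
    exponents the first index comes first. *)
Lemma rank_perm_peak (one two k : 'I_N) m : one = 0%N :> nat ->
    two = 1%N :> nat -> k != one -> (0 < m)%N ->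
  rank_perm (peak_mnm k m) k = one /\ rank_perm (peak_mnm k m) one = two.
Proof.
move=> one0 two1 k1 m0; set b := peak_mnm k m; set w := rank_perm b.
have wk j : j != k -> (w k < w j)%N.
  move=> jk; rewrite -rank_beforeP /rank_before !peak_mnmE eqxx (negbTE jk).
  by rewrite mul1n m0.
have w1 j : j != k -> j != one -> (w one < w j)%N.
  move=> jk j1; rewrite -rank_beforeP /rank_before !peak_mnmE (negbTE jk).
  rewrite [one == k]eq_sym (negbTE k1) !mul0n eqxx /= one0 lt0n.
  by rewrite -one0 val_eqE.
have wk0 : w k = one.
  have [e|ne] := eqVneq ((w^-1)%g one) k; first by rewrite -e permKV.
  by have := wk _ ne; rewrite permKV one0.
split=> //; have k1' : one != k by rewrite eq_sym.
have [e|ne] := eqVneq ((w^-1)%g two) one; first by rewrite -e permKV.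
have nk : (w^-1)%g two != k.
  apply: contraTneq (isT) => e; have : w k = two by rewrite -e permKV.
  by rewrite wk0 => /(congr1 val) /=; rewrite one0 two1.
have := w1 _ nk ne; rewrite permKV two1.
by have := wk _ k1'; rewrite wk0 one0; case: (nat_of_ord (w one)).
Qed.

End PeakMonomials.

(* The stock [done] looks for a contradictory equation among all hypotheses,
   and thereby evaluates fractions and matrices of polynomials. *)
Ltac done_without_evaluation :=
  trivial; hnf; intros; solve
   [ do ![solve [trivial | apply: sym_equal; trivial]
         | match goal with H : is_true false |- _ => discriminate H end
         | match goal with H : true = false |- _ => discriminate H end
         | match goal with H : false = true |- _ => discriminate H end
         | contradiction | split]
   | match goal with H : ~ _ |- _ => solve [case: H; trivial] end ].

Lemma subr_scale0 (R : pzRingType) (V : lmodType R) (a : R) (x z : V) :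
  z = 0 -> x - a *: z = x.
Proof. by move=> ->; rewrite scaler0 subr0. Qed.

(** * Eigenfunctions with leading monomial x_i^m for generic kappa *)

Section GenericParameter.
Variables (F : fieldType) (N d : nat) (rho : 'S_N -> 'M[F]_d) (kappa : F).
Hypothesis rho1 : rho 1%g = 1%:M.
Hypothesis rhoM : forall w1 w2 : 'S_N, rho (w2 * w1)%g = rho w1 *m rho w2.
Variable c : 'I_d -> 'I_N -> int.
Hypothesis hJM : forall s (i : 'I_N),
  delta_mx 0 s *m (\sum_(l < N | (i < l)%N) rho (tperm i l))
    = (c s i)%:~R *: (delta_mx 0 s : 'rV[F]_d).
Hypothesis c_succ : forall s (i j : 'I_N), j = i.+1 :> nat -> c s i != c s j.
Hypothesis c_last : forall s (i : 'I_N), i.+1 = N -> c s i = 0.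
Hypothesis kappa_generic : forall a b a' b' : int,
  a%:~R + kappa * b%:~R = a'%:~R + kappa * b'%:~R -> a = a' /\ b = b'.
Variable one : 'I_N.
Hypothesis one0 : one = 0%N :> nat.
Implicit Types (f g : 'rV[{mpoly F[N]}]_d) (i j k l : 'I_N).
Implicit Types (E : 'I_N -> int) (m : nat).
Local Opaque ddiff msym mderiv dunkl cherednik wact jucys.

Local Ltac done ::= done_without_evaluation.

Notation D := (dunkl rho kappa).
Notation U := (cherednik rho kappa).
Notation spectrum := (peak_spectrum kappa).
Local Notation wa := (wact rho).
Local Notation eigen := (eigenfun rho kappa).

(** Genericity separates exponents from contents in each eigenvalue, so the top monomial can only be
    x_i^m. *)
Lemma generic_eigenfun_top m i E f : eigen (spectrum m i E) f -> f <> 0 ->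
  exists s, [/\ vcoeff (peak_mnm i m) f != 0,
     forall a, vcoeff a f != 0 -> mweight a <= mweight (peak_mnm i m)
   & forall k, E k = c s (rank_perm (peak_mnm i m) k)].
Proof.
move=> hf f0; have [b [s [hb hmax hz]]] := eigenfun_top rho1 rhoM hJM hf f0.
have {}hz k : b k = ((k == i) * m)%N /\ E k = c s (rank_perm b k).
  have := hz k; rewrite /peak_spectrum !pmulrn.
  by move/kappa_generic => [h1 h2]; split=> //; move: h1; lia.
have bE : b = peak_mnm i m by apply/mnmP => k; rewrite peak_mnmE; case: (hz k).
by rewrite -bE; exists s; split=> // k; case: (hz k).
Qed.

Lemma eigenfun_swap m i j k E f : j = k.+1 :> nat ->
    spectrum m i E k != spectrum m i E j -> eigen (spectrum m i E) f ->
  eigen (spectrum m (tperm k j i) (E \o tperm k j))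
    (wa (tperm k j) f
     - (kappa / (spectrum m i E k - spectrum m i E j))%:MP *: f).
Proof.
move=> jk ne hf l; apply: etrans (eigenfun_step rho1 rhoM jk ne hf l) _.
rewrite /= -[in LHS](tpermK k j i) peak_spectrum_perm.
by rewrite /peak_spectrum /= tpermK.
Qed.

Lemma dunkl_step (a : F) f k j : D j f = 0 ->
  D j (wa (tperm k j) f - a%:MP *: f) = wa (tperm k j) (D k f).
Proof.
move=> h; apply: etrans (dunkl_subC _ _ _ _ _ _) _.
apply: etrans (subr_scale0 _ _ h) _; apply: etrans (dunkl_wact _ rhoM _ _ _) _.
by rewrite tpermR.
Qed.

Lemma wact_tperm_eq0 i j f : wa (tperm i j) f = 0 -> f = 0.
Proof.
by move=> h; rewrite -(wact_tpermK rho1 rhoM i j f) h; apply: wact0.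
Qed.

Lemma dunkl_peak_first_eq0 m E f j : j != one ->
  eigen (spectrum m one E) f -> D j f = 0.
Proof.
have [n] := ubnP (N - j); elim: n j E f => [|n IH] j E f jn j1 hf.
  by rewrite ltn0 in jn.
have [->|/eqP f0] := eqVneq f 0; first exact: dunkl0.
have [s [_ _ hE]] := generic_eigenfun_top hf f0.
have {}hE k : E k = c s k by rewrite hE rank_perm_peak_first // perm1.
(* At the last variable the Jucys-Murphy sum is empty and the content is 0, so the eigenvalue
   equation reads f + x_j D_j f = f. *)
have [jN|jN] := eqVneq j.+1 N.
  apply: (@mulX_inj _ _ _ j); apply: (addrI f); rewrite addr0.
  have hJ : jucys rho j f = 0.
    by apply: big_pred0 => l; have := ltn_ord l; lia.
  have zE : spectrum m one E j = 1.
    by rewrite /peak_spectrum (negbTE j1) mul0n hE c_last // mulr0 addr0.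
  have := hf j; rewrite cherednikE hJ scaler0 addr0 zE mpolyC1 scale1r.
  exact.
have j'N : (j.+1 < N)%N by have := ltn_ord j; lia.
pose j' := Ordinal j'N; have jj' : j' = j.+1 :> nat by [].
have j'1 : j' != one by rewrite -val_eqE /= one0.
have ne : spectrum m one E j != spectrum m one E j'.
  rewrite /peak_spectrum (negbTE j1) (negbTE j'1) !hE.
  apply/eqP => h; have [_ e] : 1%:Z = 1%:Z /\ c s j = c s j'.
    by apply: kappa_generic; move: h; rewrite mul0n.
  by have /eqP := c_succ s jj'; rewrite e.
have tone : tperm j j' one = one by rewrite tpermD.
have hg := eigenfun_swap jj' ne hf; rewrite tone in hg.
have lt' : (N - j' < n)%N by rewrite /=; lia.
(* The induction hypothesis at [j'] applies both to f and to its image under the step; as D_j' f =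
   0, D_j' of that image is the permuted D_j f. *)
have := IH j' _ _ lt' j'1 hg; rewrite (dunkl_step _ _ (IH j' _ _ lt' j'1 hf)).
exact: wact_tperm_eq0.
Qed.

Definition peak_gap m i E k : F := m%:R + kappa * (E i - E k)%:~R.

Lemma peak_gapE m i E k : k != i ->
  spectrum m i E i - spectrum m i E k = peak_gap m i E k.
Proof.
move=> ki; rewrite /peak_spectrum /peak_gap eqxx (negbTE ki) mul1n mul0n.
rewrite intrB mulrBr -natr1; ring.
Qed.

Lemma peak_gap_neq0 m i E k : (0 < m)%N -> peak_gap m i E k != 0.
Proof.
move=> m0; apply/eqP => h; have [] : m%:Z = 0 /\ E i - E k = 0 :> int.
  by apply: kappa_generic; rewrite mulr0 addr0; exact: h.
by move: m0; lia.
Qed.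

(** Each step moves the exponent to the next variable, turns D_i f into D_j g up to the
    transposition, and multiplies the top coefficient by one factor of the product. At the last
    variable the eigenvalue equation gives the remaining linear factor. *)
Lemma vcoeff_dunkl_peak m i E f : eigen (spectrum m.+1 i E) f ->
    (forall k, (i < k)%N -> D k f = 0) ->
  vcoeff (peak_mnm i m) (D i f)
    = ((m.+1%:R + kappa * (E i)%:~R)
       * \prod_(k < N | (i < k)%N) (1 - (kappa / peak_gap m.+1 i E k) ^+ 2))
      *: vcoeff (peak_mnm i m.+1) f.
Proof.
have [n] := ubnP (N - i); elim: n i E f => [|n IH] i E f i_n hf hD.
  by rewrite ltn0 in i_n.
have [iN|iN] := eqVneq i.+1 N.
  have hJ : jucys rho i f = 0.
    by apply: big_pred0 => l; have := ltn_ord l; lia.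
  rewrite big_pred0 => [|k]; last by have := ltn_ord k; lia.
  rewrite mulr1; have := congr1 (vcoeff (peak_mnm i m.+1)) (hf i).
  rewrite cherednikE hJ scaler0 addr0 vcoeffD vcoeffC peak_mnmS vcoeff_mulX.
  rewrite /peak_spectrum eqxx mul1n -natr1 [_ + 1 + _]addrAC scalerDl scale1r.
  by rewrite [X in X = _]addrC => e; apply: addIr e.
have jN : (i.+1 < N)%N by have := ltn_ord i; lia.
pose j := Ordinal jN; have ji : j = i.+1 :> nat by [].
have ji' : j != i by rewrite -val_eqE /= neq_ltn ltnSn orbT.
have gap := peak_gapE m.+1 E ji'.
have gap0 : peak_gap m.+1 i E j != 0 by apply: peak_gap_neq0.
have ne : spectrum m.+1 i E i != spectrum m.+1 i E j by rewrite -subr_eq0 gap.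
set b := kappa / peak_gap m.+1 i E j; set s := tperm i j.
have hg := eigenfun_swap ji ne hf; rewrite gap -/b -/s tpermL in hg.
move eg : (wa s f - b%:MP *: f) => g; rewrite eg in hg.
have Djf : D j f = 0 by apply: hD; rewrite ji.
have Djg : D j g = wa s (D i f) by rewrite -eg dunkl_step.
have hDg k : (j < k)%N -> D k g = 0.
  move=> jk; have ik : (i < k)%N by rewrite ltnW.
  have tk : s k = k by rewrite tpermD // -val_eqE /= neq_ltn ?ik // -ji jk.
  rewrite -eg; apply: etrans (dunkl_subC _ _ _ _ _ _) _.
  apply: etrans (subr_scale0 _ _ (hD k ik)) _.
  apply: etrans (dunkl_wact _ rhoM _ _ _) _; rewrite tk hD //; exact: wact0.
have {IH} h : vcoeff (peak_mnm j m) (D j g) = _ := IH j _ g _ hg hDg.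
have ss : rho s *m rho s = 1%:M by rewrite -rhoM tperm2 rho1.
have s_inj (u v : 'rV_d) : u *m rho s = v *m rho s -> u = v.
  by move=> /(congr1 (mulmx^~ (rho s))); rewrite -!mulmxA ss !mulmx1.
apply: (s_inj _ _); rewrite -scalemxAl.
set x := vcoeff (peak_mnm i m.+1) f; set y := vcoeff (peak_mnm j m.+1) f.
(* The top monomial of g is the power of x_j, so the heavier power of x_i has coefficient zero in g.
   This determines y from x and leads to the factor 1 - b^2. *)
have yE : y *m rho s = b *: x.
  have : vcoeff (peak_mnm i m.+1) g = 0.
    have [->|/eqP g0] := eqVneq g 0; first exact: vcoeff0.
    have [t [_ hmax _]] := generic_eigenfun_top hg g0.
    apply/eqP; apply: contraTT isT => /hmax; rewrite leNgt.
    rewrite -(mswap_peak_mnm i j) mweight_mswap //.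
    by rewrite !peak_mnmE eqxx eq_sym (negbTE ji').
  rewrite -eg vcoeffD vcoeffN vcoeffC vcoeff_wact_tperm mswapC mswap_peak_mnm -/x -/y.
  by move/eqP; rewrite subr_eq0 => /eqP.
have yg : vcoeff (peak_mnm j m.+1) g = (1 - b ^+ 2) *: (x *m rho s).
  rewrite -eg vcoeffD vcoeffN vcoeffC vcoeff_wact_tperm mswap_peak_mnm -/x -/y.
  have -> : y = b *: (x *m rho s).
    by apply: s_inj; rewrite yE -scalemxAl -mulmxA ss mulmx1.
  by rewrite scalerA -expr2 scalerBl scale1r.
have -> : vcoeff (peak_mnm i m) (D i f) *m rho s = vcoeff (peak_mnm j m) (D j g).
  by rewrite Djg vcoeff_wact_tperm mswap_peak_mnm.
rewrite h; last by rewrite /=; lia.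
rewrite yg scalerA; congr (_ *: _); rewrite /= tpermR -mulrA; congr (_ * _).
rewrite [RHS](bigD1 j) //= -/b mulrC; congr (_ * _).
apply: eq_big => [k|k jk]; first by rewrite -!val_eqE /=; lia.
have tk : s k = k by rewrite tpermD // -val_eqE /= neq_ltn ?jk // (ltnW jk).
by rewrite /peak_gap /= tpermR tk.
Qed.

End GenericParameter.

Lemma tofrac_div_inj (p q p' q' : {poly rat}) :
    tofrac q != 0 -> tofrac q' != 0 ->
  tofrac p / tofrac q = tofrac p' / tofrac q' -> p * q' = p' * q.
Proof.
move=> q0 q0' /eqP; rewrite (eqr_div _ _ q0 q0').
by rewrite -[X in X == _]tofracM -[X in _ == X]tofracM tofrac_eq => /eqP.
Qed.

(** * Values and poles of rational functions at a point *)

Section RationalFunctionValues.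
Local Ltac done ::= done_without_evaluation.

Variable k0 : rat.
Implicit Types (f g : Qk) (c : rat).
Local Notation fv := (frac_value k0).

Lemma tofrac_horner_neq0 (q : {poly rat}) : q.[k0] != 0 -> tofrac q != 0.
Proof. by rewrite tofrac_eq0; apply: contraNneq => ->; rewrite horner0. Qed.

Lemma frac_value_unique f c c' : fv f c -> fv f c' -> c = c'.
Proof.
move=> [p [q [hq -> ->]]] [p' [q' [hq' e ->]]].
have q0 := tofrac_horner_neq0 hq; have q'0 := tofrac_horner_neq0 hq'.
have h := tofrac_div_inj q0 q'0 e.
by clear e q0 q'0; apply/eqP; rewrite eqr_div // -!hornerM h.
Qed.

Lemma frac_value_poly p : fv (tofrac p) p.[k0].
Proof. by exists p, 1; rewrite hornerC oner_neq0 tofrac1 !divr1. Qed.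

Lemma frac_value_const c : fv (constQk c) c.
Proof. by have := frac_value_poly c%:P; rewrite hornerC. Qed.

Lemma frac_value0 : fv 0 0.
Proof. by have := frac_value_poly 0; rewrite horner0 tofrac0. Qed.

Lemma frac_value1 : fv 1 1.
Proof. by have := frac_value_poly 1; rewrite hornerC tofrac1. Qed.

Lemma frac_value_kappa : fv kappa_gen k0.
Proof. by have := frac_value_poly 'X; rewrite hornerX. Qed.

Lemma frac_valueD f g c c' : fv f c -> fv g c' -> fv (f + g) (c + c').
Proof.
move=> [p [q [hq -> ->]]] [p' [q' [hq' -> ->]]].
have q0 := tofrac_horner_neq0 hq; have q'0 := tofrac_horner_neq0 hq'.
exists (p * q' + p' * q), (q * q'); rewrite hornerM mulf_neq0 //; split=> //.
  apply: etrans (addf_div _ _ q0 q'0) _.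
  by rewrite (tofracD (p * q')) (tofracM p) (tofracM p') (tofracM q).
by clear q0 q'0; rewrite addf_div // hornerD !hornerM.
Qed.

Lemma frac_valueM f g c c' : fv f c -> fv g c' -> fv (f * g) (c * c').
Proof.
move=> [p [q [hq -> ->]]] [p' [q' [hq' -> ->]]].
exists (p * p'), (q * q'); rewrite hornerM mulf_neq0 //; split=> //.
  by apply: etrans (mulf_div _ _ _ _) _; rewrite (tofracM p) (tofracM q).
by rewrite mulf_div !hornerM.
Qed.

Lemma frac_valueN f c : fv f c -> fv (- f) (- c).
Proof.
move=> [p [q [hq -> ->]]]; exists (- p), q; split=> //.
  by rewrite tofracN mulNr.
by rewrite hornerN mulNr.
Qed.

Lemma frac_valueV f c : fv f c -> c != 0 -> fv f^-1 c^-1.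
Proof.
move=> [p [q [hq -> ->]]] h; exists q, p; rewrite !invf_div; split=> //.
by apply: contraNneq h => ->; rewrite mul0r.
Qed.

Lemma frac_value_sum (I : Type) (r : seq I) (P : pred I) (G : I -> Qk) H :
  (forall i, P i -> fv (G i) (H i)) ->
  fv (\sum_(i <- r | P i) G i) (\sum_(i <- r | P i) H i).
Proof.
move=> h; elim/big_rec2: _ => [|i x y Pi hxy]; first exact: frac_value0.
exact: frac_valueD (h i Pi) hxy.
Qed.

Lemma frac_valueMn f c n : fv f c -> fv (f *+ n) (c *+ n).
Proof.
move=> h; elim: n => [|n IH]; first by rewrite !mulr0n; apply: frac_value0.
by rewrite !mulrS; apply: frac_valueD.
Qed.

Lemma frac_value_nat n : fv n%:R n%:R.
Proof. exact/frac_valueMn/frac_value1. Qed.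

Lemma frac_value_int (z : int) : fv z%:~R z%:~R.
Proof.
case: z => n; first exact: frac_value_nat.
by rewrite NegzE !mulrNz; apply/frac_valueN/frac_value_nat.
Qed.

Lemma frac_valueX f c n : fv f c -> fv (f ^+ n) (c ^+ n).
Proof.
move=> h; elim: n => [|n IH]; first by rewrite !expr0; apply: frac_value1.
by rewrite !exprS; apply: frac_valueM.
Qed.

Definition kappa_sub : Qk := tofrac ('X - k0%:P).

Lemma kappa_subE : kappa_sub = kappa_gen - constQk k0.
Proof. by rewrite /kappa_sub tofracB. Qed.

Lemma kappa_sub_neq0 : kappa_sub != 0.
Proof. by rewrite tofrac_eq0 polyXsubC_eq0. Qed.

Lemma frac_value_kappa_sub : fv kappa_sub 0.
Proof.
by have := frac_value_poly ('X - k0%:P); rewrite hornerXsubC subrr.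
Qed.

Lemma frac_value_div_kappa_sub f : fv f 0 -> exists c, fv (f / kappa_sub) c.
Proof.
move=> [p [q [hq -> /esym/eqP]]].
rewrite mulf_eq0 invr_eq0 (negbTE hq) orbF => /factor_theorem[r ->].
exists (r.[k0] / q.[k0]); exists r, q; split=> //.
by rewrite tofracM mulrAC mulfK // kappa_sub_neq0.
Qed.

Lemma Qk_divE f : exists p q : {poly rat}, q != 0 /\ f = tofrac p / tofrac q.
Proof.
elim/quotW: f => x; exists (frac x).1, (frac x).2.
have d0 : (frac x).2 != 0 by apply: denom_ratioP.
split=> //; have d0' : tofrac (frac x).2 != 0 by rewrite tofrac_eq0.
apply: (mulIf d0'); rewrite divfK //; apply/eqP.
rewrite /GRing.mul /= !piE /FracField.mulf.
rewrite FracField.equivfE !numden_Ratio ?mulf_neq0 ?oner_eq0 //.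
by rewrite !mulr1 mulrC.
Qed.

(** The exponent is the multiplicity of k0 as a root of the denominator. *)
Lemma pole_bounded f : exists e c, fv (kappa_sub ^+ e * f) c.
Proof.
have [p [q [q0 ->]]] := Qk_divE f.
have [e [r hr qE]] := multiplicity_XsubC q k0; rewrite q0 /= in hr.
exists e, (p.[k0] / r.[k0]); exists p, r; split=> //.
rewrite qE tofracM tofracXn -/kappa_sub invfM mulrCA; congr (_ * _).
by rewrite mulrCA divff ?mulr1 // expf_neq0 ?kappa_sub_neq0.
Qed.

Lemma pole_bounded_mono f e e' : (e <= e')%N ->
  (exists c, fv (kappa_sub ^+ e * f) c) -> exists c, fv (kappa_sub ^+ e' * f) c.
Proof.
move=> ee [c hc]; exists (0 ^+ (e' - e) * c).
rewrite -(subnK ee) exprD -mulrA addnK; apply: frac_valueM hc.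
exact/frac_valueX/frac_value_kappa_sub.
Qed.

Lemma poles_bounded (r : seq Qk) :
  exists e, forall f, f \in r -> exists c, fv (kappa_sub ^+ e * f) c.
Proof.
elim: r => [|f r [e he]]; first by exists 0%N => f; rewrite in_nil.
have [e' he'] := pole_bounded f; exists (maxn e e') => g.
rewrite inE => /orP[/eqP ->|/he].
  exact: pole_bounded_mono (leq_maxr _ _) he'.
exact/pole_bounded_mono/leq_maxl.
Qed.

End RationalFunctionValues.

Lemma intr_poly (F : nzRingType) (z : int) : z%:~R = (z%:~R)%:P :> {poly F}.
Proof. by rewrite rmorph_int. Qed.

(** Both sides are polynomials of degree at most one in the indeterminate, compared coefficient by
    coefficient. *)
Lemma kappa_gen_generic (a b a' b' : int) :
  a%:~R + kappa_gen * b%:~R = a'%:~R + kappa_gen * b'%:~R -> a = a' /\ b = b'.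
Proof.
rewrite -!(rmorph_int (@FracField.tofrac {poly rat})) -!tofracM -!tofracD.
move/eqP; rewrite tofrac_eq !intr_poly => /eqP h.
split; apply/eqP; rewrite -(eqr_int rat).
  by have := congr1 (coefp 0) h; rewrite /= !coefD !coefC !coefXM /= !addr0 => ->.
have := congr1 (coefp 1) h; rewrite /= !coefD !coefC !coefXM !coefC /= !add0r.
by move=> ->.
Qed.

(** * Evaluating vector-valued polynomials and operators at a parameter *)

Section Specialization.
Variables (k0 : rat) (N : nat) (tau : seq nat).
Variable rho : 'S_N -> 'M[rat]_(ytdim N tau).
Local Notation d := (ytdim N tau).
Implicit Types (J : 'rV[{mpoly Qk[N]}]_d) (K : 'rV[{mpoly rat[N]}]_d).
Implicit Types (v u : 'rV[Qk]_d) (x y : 'rV[rat]_d) (i j l : 'I_N).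
Implicit Types (b : 'X_{1..N}).
Local Opaque ddiff msym mderiv.
Local Ltac done ::= done_without_evaluation.

Local Notation fv := (frac_value k0).

Definition vec_value v x : Prop := forall s, fv (v 0 s) (x 0 s).

Lemma vec_valueD v x u y :
  vec_value v x -> vec_value u y -> vec_value (v + u) (x + y).
Proof. by move=> h h' s; rewrite !mxE; apply: frac_valueD. Qed.

Lemma vec_valueN v x : vec_value v x -> vec_value (- v) (- x).
Proof. by move=> h s; rewrite !mxE; apply: frac_valueN. Qed.

Lemma vec_value0 : vec_value 0 0.
Proof. by move=> s; rewrite !mxE; apply: frac_value0. Qed.

Lemma vec_valueZ f c v x :
  fv f c -> vec_value v x -> vec_value (f *: v) (c *: x).
Proof. by move=> h h' s; rewrite !mxE; apply: frac_valueM. Qed.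

Lemma vec_valueMn v x n : vec_value v x -> vec_value (v *+ n) (x *+ n).
Proof. by move=> h s; rewrite !mulmxnE; apply: frac_valueMn. Qed.

Lemma vec_value_sum (I : Type) (r : seq I) (P : pred I) (G : I -> 'rV[Qk]_d)
    (G0 : I -> 'rV[rat]_d) : (forall a, P a -> vec_value (G a) (G0 a)) ->
  vec_value (\sum_(i <- r | P i) G i) (\sum_(i <- r | P i) G0 i).
Proof.
move=> h; elim/big_rec2: _ => [|a u x Pa hux]; first exact: vec_value0.
exact: vec_valueD (h a Pa) hux.
Qed.

Lemma vec_value_rep v x w :
  vec_value v x -> vec_value (v *m gen_rep rho w) (x *m rho w).
Proof.
move=> h s; rewrite !mxE; apply: frac_value_sum => t _.
by rewrite mxE; apply: frac_valueM => //; apply: frac_value_const.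
Qed.

Lemma specializes_toE J K : specializes_to k0 J K <->
  forall b, vec_value (vcoeff b J) (vcoeff b K).
Proof.
split=> h; first by move=> b s; rewrite !mxE; apply: h.
by move=> s b; have := h b s; rewrite !mxE.
Qed.

Lemma specializes_to_unique J K K' :
  specializes_to k0 J K -> specializes_to k0 J K' -> K = K'.
Proof.
move=> h h'; apply/rowP => s; apply/mpolyP => b.
exact: frac_value_unique (h s b) (h' s b).
Qed.

Lemma specializes_to0 : specializes_to k0 (0 : 'rV[{mpoly Qk[N]}]_d) 0.
Proof. by apply/specializes_toE => b; rewrite !vcoeff0; apply: vec_value0. Qed.

Lemma specializes_toZ f c J K : fv f c -> specializes_to k0 J K ->
  specializes_to k0 (f%:MP *: J) (c%:MP *: K).
Proof.
move=> hf /specializes_toE h; apply/specializes_toE => b.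
by rewrite !vcoeffC; apply: vec_valueZ.
Qed.

Lemma specializes_to_dunkl i J K : specializes_to k0 J K ->
  specializes_to k0 (dunkl (gen_rep rho) kappa_gen i J) (dunkl rho k0 i K).
Proof.
move=> /specializes_toE h; apply/specializes_toE => b; rewrite !vcoeff_dunkl.
apply: vec_valueD; first exact/vec_valueMn/h.
apply: vec_valueZ; first exact: frac_value_kappa.
apply: vec_value_sum => j ji; apply: vec_value_rep.
rewrite !vcoeff_ddiff 1?eq_sym //; apply: vec_value_sum => k _.
by apply: vec_valueD; last apply: vec_valueN; apply: h.
Qed.

Lemma specializes_to_cherednik i J K : specializes_to k0 J K ->
  specializes_to k0 (cherednik (gen_rep rho) kappa_gen i J) (cherednik rho k0 i K).
Proof.
move=> hJ; have hD := specializes_to_dunkl i hJ.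
move/specializes_toE: hD => hD; move/specializes_toE: hJ => h.
apply/specializes_toE => b; rewrite !cherednikE !vcoeffD !vcoeffC !vcoeff_jucys.
apply: vec_valueD; last first.
  apply: vec_valueZ; first exact: frac_value_kappa.
  by apply: vec_value_sum => l _; apply/vec_value_rep/h.
apply: vec_valueD => //.
have [bi|bi] := posnP (b i); first by rewrite !vcoeff_mulX0 //; apply: vec_value0.
have -> : b = (b - U_(i) + U_(i))%MM.
  by apply/mnmP => l; rewrite !mnmE; have [<-|] := eqVneq i l; lia.
by rewrite !vcoeff_mulX.
Qed.

Lemma mpoly_value_exists (p : {mpoly Qk[N]}) :
    (forall b, exists c, fv p@_b c) ->
  exists p0 : {mpoly rat[N]}, forall b, fv p@_b p0@_b.
Proof.
elim/mpolyind: p => [|a b p bp a0 IH] h.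
  by exists 0 => b; rewrite !mcoeff0; apply: frac_value0.
(* The monomial b does not occur in the rest [p], so regularity of the sum passes to each of the two
   parts. *)
have pb : p@_b = 0 by apply/eqP; rewrite mcoeff_eq0.
have [b' | p0 hp0] := IH.
  have [->|bb'] := eqVneq b' b; first by exists 0; rewrite pb; apply: frac_value0.
  have [c hc] := h b'; exists c; move: hc.
  by rewrite mcoeffD mcoeffZ mcoeffX eq_sym (negbTE bb') mulr0 add0r.
have [c hc] := h b; rewrite mcoeffD mcoeffZ mcoeffX eqxx mulr1 pb addr0 in hc.
exists (c *: 'X_[b] + p0) => b'; rewrite !mcoeffD !mcoeffZ !mcoeffX.
apply: frac_valueD (hp0 b'); apply: frac_valueM hc _.
by case: (b == b'); [apply: frac_value1 | apply: frac_value0].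
Qed.

Lemma specialization_exists J :
    (forall s b, exists c, fv (J 0 s)@_b c) ->
  exists K, specializes_to k0 J K.
Proof.
move=> h; have h' s := mpoly_value_exists (h s).
have [P hP] := fin_all_exists h'.
by exists (\row_s P s) => s b; rewrite mxE; apply: hP.
Qed.

Lemma scaled_coeff f J s b : ((f%:MP *: J) 0 s)@_b = f * (J 0 s)@_b.
Proof. by rewrite mxE mul_mpolyC mcoeffZ. Qed.

Lemma specializes_to_scaled0 f J : specializes_to k0 (f%:MP *: J) 0 ->
  forall s b, fv (f * (J 0 s)@_b) 0.
Proof. by move=> h s b; have := h s b; rewrite scaled_coeff mxE mcoeff0. Qed.

Lemma specialization_exists_scaled J :
  exists e K, specializes_to k0 ((kappa_sub k0 ^+ e)%:MP *: J) K.
Proof.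
pose r := flatten [seq [seq (J 0 s)@_b | b <- msupp (J 0 s)] | s : 'I_d].
have [e he] := poles_bounded k0 r; exists e; apply: specialization_exists => s b.
rewrite scaled_coeff.
have [bs|bs] := boolP (b \in msupp (J 0 s)).
  apply: he; apply/flatten_mapP; exists s; first by rewrite mem_enum.
  by apply/mapP; exists b.
move: bs; rewrite -mcoeff_eq0 => /eqP ->.
by exists 0; rewrite mulr0; apply: frac_value0.
Qed.

(** If the rescaled polynomial vanishes at k0, each coefficient has a factor kappa - k0 to spare;
    this lowers the bound on the pole order by one. *)
Lemma specializes_to_div e J :
    specializes_to k0 ((kappa_sub k0 ^+ e.+1)%:MP *: J) 0 ->
  exists K, specializes_to k0 ((kappa_sub k0 ^+ e)%:MP *: J) K.
Proof.
move=> h; apply: specialization_exists => s b; rewrite scaled_coeff.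
have [c hc] := frac_value_div_kappa_sub (specializes_to_scaled0 h s b).
exists c; move: hc; move: (kappa_sub_neq0 k0).
by move: (kappa_sub k0) (_@__) => t a t0; rewrite exprSr mulrAC mulfK.
Qed.

Lemma const_mx_map (m n : nat) (A : 'M[rat]_(m, n)) :
  map_mx constQk A = map_mx (@FracField.tofrac {poly rat} \o polyC) A.
Proof. by []. Qed.

Lemma gen_rep1 : rho 1%g = 1%:M -> gen_rep rho 1%g = 1%:M.
Proof. by rewrite /gen_rep const_mx_map => ->; rewrite map_mx1. Qed.

Lemma gen_repM : (forall w1 w2, rho (w2 * w1)%g = rho w1 *m rho w2) ->
  forall w1 w2, gen_rep rho (w2 * w1)%g = gen_rep rho w1 *m gen_rep rho w2.
Proof. by move=> h w1 w2; rewrite /gen_rep !const_mx_map h map_mxM. Qed.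

Definition tableau_content (s : 'I_d) i : int := content (enum_val s) i.

Lemma delta_jucys_murphy : is_partition N tau -> is_young_rep rho -> forall s i,
  delta_mx 0 s *m (\sum_(l < N | (i < l)%N) rho (tperm i l))
    = (tableau_content s i)%:~R *: (delta_mx 0 s : 'rV[rat]_d).
Proof.
move=> htau hrho s i; have := ytvec_jucys_murphy htau hrho (enum_val s) i.
by rewrite /ytvec enum_valK.
Qed.

Lemma delta_jucys_murphy_gen : is_partition N tau -> is_young_rep rho ->
  forall s i,
  delta_mx 0 s *m (\sum_(l < N | (i < l)%N) gen_rep rho (tperm i l))
    = (tableau_content s i)%:~R *: (delta_mx 0 s : 'rV[Qk]_d).
Proof.
move=> htau hrho s i; have := delta_jucys_murphy htau hrho s i.
move=> /(congr1 (map_mx (@FracField.tofrac {poly rat} \o polyC))).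
rewrite map_mxM map_mxZ map_delta_mx rmorph_int => <-; congr (_ *m _).
by rewrite raddf_sum; apply: eq_bigr => l _; rewrite /gen_rep const_mx_map.
Qed.

End Specialization.

(** * Order of vanishing of the factor in front of the leading coefficient *)

Section LeadingCoefficient.
Variable k0 : rat.
Local Ltac done ::= done_without_evaluation.

Local Notation fv := (frac_value k0).
Local Notation L := (kappa_sub k0).

(** The order of f at k0 is a - b, kept as two natural numbers so that zeros of numerators and of
    denominators are counted separately. *)
Definition unit_times (f : Qk) (a b : nat) : Prop :=
  exists u c, [/\ fv u c, c != 0 & f = u * (L ^+ a / L ^+ b)].

Lemma unit_timesM f g a b a' b' : unit_times f a b -> unit_times g a' b' ->
  unit_times (f * g) (a + a') (b + b').
Proof.
move=> [u [c [hu hc ->]]] [u' [c' [hu' hc' ->]]].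
exists (u * u'), (c * c'); split; [exact: frac_valueM | exact: mulf_neq0 |].
by rewrite mulrACA mulf_div !exprD.
Qed.

Lemma unit_timesV f a b : unit_times f a b -> unit_times f^-1 b a.
Proof.
move=> [u [c [hu hc ->]]]; exists u^-1, c^-1.
by split; [exact: frac_valueV | rewrite invr_eq0 | rewrite invfM invf_div].
Qed.

Lemma unit_times_value0 f a b : (b < a)%N -> unit_times f a b -> fv f 0.
Proof.
move=> ba [u [c [hu hc ->]]]; have L0 := kappa_sub_neq0 k0.
rewrite -(subnK (ltnW ba)) exprD mulfK ?expf_neq0 //.
have -> : 0 = c * 0 ^+ (a - b) by rewrite expr0n subn_eq0 leqNgt ba mulr0.
exact/frac_valueM/frac_valueX/frac_value_kappa_sub.
Qed.

Variables (m : nat) (n z e1 : int).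
Hypotheses (m_gt0 : (0 < m)%N) (n_neq0 : n != 0).
Hypotheses (nE : n = e1 - z) (k0E : k0 = - (m%:R / n%:~R)).

Definition linear_factor (x : int) : Qk := m%:R + kappa_gen * (e1 - x)%:~R.

Lemma linear_factor_unit x : unit_times (linear_factor x) (x == z) 0.
Proof.
have n0 : n%:~R != 0 :> rat by rewrite intr_eq0.
have mk0 : m%:R = - (k0 * n%:~R) by rewrite k0E mulNr divfK // opprK.
have [->|xz] := eqVneq x z.
  (* At x = z the linear factor is n (kappa - k0), so the unit is n. *)
  exists n%:~R, n%:~R; split=> //; first exact: frac_value_int.
  rewrite expr1 expr0 divr1 kappa_subE /linear_factor -nE mulrBr mulrC addrC.
  have -> : m%:R = constQk m%:R by rewrite /constQk !rmorph_nat.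
  have -> : n%:~R = constQk n%:~R by rewrite /constQk !rmorph_int.
  rewrite mk0 /constQk polyCN polyCM tofracN tofracM; congr (_ - _).
  by rewrite mulrC.
exists (linear_factor x), (m%:R + k0 * (e1 - x)%:~R); split.
- apply: frac_valueD; first exact: frac_value_nat.
  by apply: frac_valueM; [exact: frac_value_kappa | exact: frac_value_int].
(* The value at k0 is k0 (z - x). *)
- rewrite mk0 nE -mulrN -rmorphN -mulrDr -rmorphD mulf_neq0 //.
    rewrite k0E oppr_eq0 mulf_neq0 ?invr_eq0 // pnatr_eq0 -lt0n.
    exact: m_gt0.
  by rewrite intr_eq0; move: xz; lia.
- by rewrite !expr0 divr1 mulr1.
Qed.

Lemma linear_factor_neq0 x : linear_factor x != 0.
Proof.
apply/eqP => h; have [] : m%:Z = 0 /\ e1 - x = 0 :> int.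
  by apply: kappa_gen_generic; rewrite mulr0 addr0; exact: h.
by move: m_gt0; lia.
Qed.

(** Shifting x by one changes the linear factor by kappa, so this is a difference of two squares. *)
Lemma linear_factor_quotient x :
  1 - (kappa_gen / linear_factor x) ^+ 2
    = linear_factor (x + 1) * linear_factor (x - 1) / linear_factor x ^+ 2.
Proof.
have hp : linear_factor (x - 1) = linear_factor x + kappa_gen.
  rewrite /linear_factor (_ : e1 - (x - 1) = e1 - x + 1); last by lia.
  by rewrite [(_ + 1)%:~R]intrD mulrDr mulr1 addrA.
have hm : linear_factor (x + 1) = linear_factor x - kappa_gen.
  rewrite /linear_factor (_ : e1 - (x + 1) = e1 - x - 1); last by lia.
  by rewrite [(_ - 1)%:~R]intrB mulrBr mulr1 addrA.
rewrite hp hm -subr_sqr mulrBl divff ?expf_neq0 ?linear_factor_neq0 //.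
by rewrite expr_div_n.
Qed.

Lemma linear_factor_prod (I : finType) (P : pred I) (E : I -> int) :
  unit_times (\prod_(k | P k) (1 - (kappa_gen / linear_factor (E k)) ^+ 2))
    (\sum_(k | P k) ((E k == z - 1)%R + (E k == z + 1)%R))
    (\sum_(k | P k) (E k == z) * 2).
Proof.
elim/big_rec3: _ => [|k b a f Pk hf].
  by exists 1, 1; rewrite oner_neq0 expr0 divr1 mulr1; split=> //; exact: frac_value1.
apply: unit_timesM => //; rewrite linear_factor_quotient.
rewrite -[((_ == (z - 1)%R) + _)%N]addn0 -[(_ * 2)%N]add0n.
apply: unit_timesM.
  have -> : (E k == z - 1) = (E k + 1 == z) by lia.
  have -> : (E k == z + 1) = (E k - 1 == z) by lia.
  exact: (unit_timesM (linear_factor_unit _) (linear_factor_unit _)).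
apply: unit_timesV; rewrite expr2 muln2 -addnn -[0%N]addn0.
exact: unit_timesM (linear_factor_unit _) (linear_factor_unit _).
Qed.

End LeadingCoefficient.

Lemma vcoeff_tensor (F : fieldType) (N d : nat) b (p : {mpoly F[N]}) (v : 'rV[F]_d) :
  vcoeff b (tensor p v) = p@_b *: v.
Proof. by apply/rowP => s; rewrite !mxE mulrC mul_mpolyC mcoeffZ mulrC. Qed.

Lemma mtri_irrefl N (a : 'X_{1..N}) : mtri a a = false.
Proof. by rewrite /mtri /dominates !eqxx. Qed.

Lemma peak_mnm_of_dvd N m (b : 'X_{1..N}) : (0 < m)%N ->
    (forall k, (m %| b k)%N) -> mdeg b = m ->
  exists k, b = peak_mnm k m.
Proof.
move=> m0 hb bm; have [k bk] : exists k, b k != 0%N.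
  apply/existsP; apply: contraTT m0; rewrite negb_exists => /forallP h.
  rewrite -bm mdegE big1 // => k _; apply/eqP; have := h k.
  by rewrite negbK.
move: bm; rewrite mdegE (bigD1 k) //= => bm; exists k.
have mk : (m <= b k)%N by apply: dvdn_leq; rewrite ?lt0n.
have [s0 bkm] : (\sum_(i < N | i != k) b i = 0 /\ b k = m)%N.
  by move: bm mk; move: (\sum_(i < N | i != k) b i)%N => t; lia.
apply/mnmP => l; rewrite peak_mnmE; have [->|lk] := eqVneq l k.
  by rewrite mul1n.
rewrite mul0n; apply/eqP; rewrite -leqn0 -s0 (bigD1 l) //=; exact: leq_addr.
Qed.

Lemma cherednikC (F : fieldType) (N d : nat) (rho : 'S_N -> 'M[F]_d) (kappa : F)
    i a (f : 'rV[{mpoly F[N]}]_d) :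
  cherednik rho kappa i (a%:MP *: f) = a%:MP *: cherednik rho kappa i f.
Proof.
have c0 : cherednik rho kappa i 0 = 0.
  apply: etrans (etrans (cherednik_linear rho kappa i (-1) 0 0) _).
    by rewrite scaler0 addr0.
  by rewrite mpolyCN mpolyC1 scaleN1r addNr.
apply: etrans (etrans (cherednik_linear rho kappa i a f 0) _).
  by rewrite addr0.
by rewrite c0 addr0.
Qed.

(** * The Jack polynomial at the singular parameter *)

Section JackSpecialization.
Variables (N : nat) (hN : (2 <= N)%N) (tau : seq nat).
Hypothesis htau : is_partition N tau.
Variable rho : 'S_N -> 'M[rat]_(ytdim N tau).
Hypothesis hrho : is_young_rep rho.
Variables (S : rsyt N tau) (m : nat).
Hypothesis hm : (1 <= m)%N.
Variables (z n : int).
Local Notation one := (first_entry hN).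
Hypothesis hz : z \in Zhat S one.
Hypothesis hn : n = content S one - z.
Hypothesis hn0 : n <> 0.
Hypothesis hmn : gcdz m%:Z n = 1.
Local Opaque ddiff msym mderiv dunkl cherednik wact jucys.
Local Ltac done ::= done_without_evaluation.

Local Notation k0 := (- (m%:R / n%:~R) : rat).
Local Notation E := (fun k => content S k).
Local Notation c := (@tableau_content N tau).
Implicit Types (J : 'rV[{mpoly Qk[N]}]_(ytdim N tau)).
Implicit Types (f : 'rV[{mpoly rat[N]}]_(ytdim N tau)).

Let one0 : one = 0%N :> nat. Proof. by []. Qed.
Let rho1 : rho 1%g = 1%:M. Proof. by case: hrho. Qed.
Let rhoM : forall w1 w2, rho (w2 * w1)%g = rho w1 *m rho w2.
Proof. by case: hrho. Qed.
Let n0 : n != 0. Proof. exact/eqP. Qed.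

Lemma spectrum_compare (a b : nat) (x y : int) :
  a%:R + k0 * x%:~R = b%:R + k0 * y%:~R -> n * (a%:Z - b%:Z) = m%:Z * (x - y).
Proof.
move=> h; have nr : n%:~R != 0 :> rat by rewrite intr_eq0.
have e : (a%:R - b%:R) = m%:R / n%:~R * (x%:~R - y%:~R) :> rat.
  move: h; move: (_ / _) (a%:R) (b%:R) (x%:~R) (y%:~R) => t a' b' x' y' h.
  have -> : a' - b' = (a' + - t * x') - (b' + - t * y') + t * (x' - y') by ring.
  by rewrite h subrr add0r.
apply: (@intr_inj rat); rewrite !intrM !intrB -!pmulrn e.
by rewrite mulrA [n%:~R * _]mulrC divfK.
Qed.

Lemma spectrum_divisible (t x : int) : n * t = m%:Z * x -> (m%:Z %| t)%Z.
Proof.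
move=> h; have cop : coprimez m%:Z n by rewrite /coprimez hmn.
by rewrite -(Gauss_dvdzr _ cop) h dvdz_mulr.
Qed.

Lemma top_coefficient_neq0 f : homogeneous_deg m f ->
    eigenfun rho k0 (peak_spectrum k0 m one E) f -> f <> 0 ->
  vcoeff (peak_mnm one m) f != 0.
Proof.
move=> hom hf f0.
have [b [s [hb _ hs]]] := eigenfun_top rho1 rhoM (delta_jucys_murphy htau hrho) hf f0.
have {}hs k : n * (((k == one) * m)%:Z - (b k)%:Z)
    = m%:Z * (content S k - c s (rank_perm b k)).
  by have /spectrum_compare <- := hs k; congr (_ * _); lia.
have bm : mdeg b = m by apply/eqP; apply: contraNT hb => /hom ->.
(* As gcd(m, n) = 1, equality of eigenvalues makes every exponent of b divisible by m, and the total
   degree is m. *)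
have [k bk] : exists k, b = peak_mnm k m.
  apply: peak_mnm_of_dvd => // k; have := spectrum_divisible (hs k).
  rewrite -[(m %| b k)%N]/(m%:Z %| (b k)%:Z)%Z => h.
  case/dvdzP: h => q e; apply/dvdzP; exists ((k == one)%:Z - q).
  by move: e; rewrite PoszM mulrBl => <-; rewrite subKr.
have [k1|k1] := eqVneq k one; first by rewrite -k1 -bk.
exfalso; pose two : 'I_N := Ordinal hN.
have [wk w1] := rank_perm_peak (two := two) one0 erefl k1 hm.
have m0 : m%:Z != 0 by rewrite -lt0n.
have zS : z != content S one by rewrite eq_sym -subr_eq0 -hn.
have k1' : one != k by rewrite eq_sym.
apply: (no_exchanged_content htau (S' := enum_val s) (two := two) one0 erefl
  hz zS k1 wk w1).
  (* At the first index the comparison reads n m = m (c_1 - x), with x the content of [two]; hence x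
     = z. At the indices other than the first and [k] the exponents agree, so the contents do
     too. *)
  have := hs one; rewrite bk peak_mnmE (negbTE k1') eqxx mul0n mul1n subr0 w1.
  rewrite mulrC => /(mulfI m0); rewrite hn /tableau_content.
  by move: (content (enum_val s) two) (content S one) => x y; lia.
move=> j j1 jk; have := hs j; rewrite bk peak_mnmE (negbTE j1) (negbTE jk).
rewrite !mul0n subrr mulr0 => /esym/eqP.
rewrite mulf_eq0 (negbTE m0) /= subr_eq0 => /eqP ->.
by rewrite /tableau_content.
Qed.

(** In degree m - 1 an exponent divisible by m is 0, so only the first variable can occur in the top
    monomial. *)
Lemma lower_coefficient_neq0 f m' : m = m'.+1 -> homogeneous_deg m' f ->
    eigenfun rho k0 (peak_spectrum k0 m' one E) f -> f <> 0 ->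
  vcoeff (peak_mnm one m') f != 0.
Proof.
move=> mE hom hf f0.
have [b [s [hb _ hs]]] := eigenfun_top rho1 rhoM (delta_jucys_murphy htau hrho) hf f0.
have bm : mdeg b = m' by apply/eqP; apply: contraNT hb => /hom ->.
have bk k : k != one -> b k = 0%N.
  move=> k1; have /spectrum_compare/spectrum_divisible := hs k.
  rewrite (negbTE k1) mul0n => h.
  have {h} : (m %| b k)%N.
    rewrite -[(m %| b k)%N]/(m%:Z %| (b k)%:Z)%Z.
    case/dvdzP: h => q e; apply/dvdzP; exists (- q).
    by rewrite mulNr -e; lia.
  have : (b k < m)%N.
    by rewrite mE ltnS -bm mdegE (bigD1 k) //= leq_addr.
  case: (b k) => // t lt /dvdn_leq; lia.
suff bE : b = peak_mnm one m' by rewrite -bE.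
apply/mnmP => l; rewrite peak_mnmE; have [->|lk] := eqVneq l one; last exact: bk.
by rewrite mul1n -bm mdegE (bigD1 one) //= big1 ?addn0 // => k /bk.
Qed.

Let gen1 : gen_rep rho 1%g = 1%:M. Proof. exact: gen_rep1. Qed.
Let genM : forall w1 w2, gen_rep rho (w2 * w1)%g = gen_rep rho w1 *m gen_rep rho w2.
Proof. exact: gen_repM. Qed.
Local Notation gen_eigenfun := (eigenfun (gen_rep rho) kappa_gen).
Local Notation gen_spectrum := (peak_spectrum kappa_gen).

Lemma homogeneous_specialization m' J f :
  homogeneous_deg m' J -> specializes_to k0 J f -> homogeneous_deg m' f.
Proof.
move=> hom /specializes_toE h b bm; apply/rowP => s.
apply: frac_value_unique (h b s) _; rewrite hom // !mxE; exact: frac_value0.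
Qed.

Lemma peak_spectrum_value m' i (e : 'I_N -> int) k :
  frac_value k0 (gen_spectrum m' i e k) (peak_spectrum k0 m' i e k).
Proof.
apply: frac_valueD; first exact: frac_value_nat.
by apply: frac_valueM; [exact: frac_value_kappa | exact: frac_value_int].
Qed.

Lemma eigenfun_specialization m' i (e : 'I_N -> int) J f :
    gen_eigenfun (gen_spectrum m' i e) J -> specializes_to k0 J f ->
  eigenfun rho k0 (peak_spectrum k0 m' i e) f.
Proof.
move=> hJ h k; apply: specializes_to_unique (specializes_to_cherednik rho k h) _.
rewrite hJ; exact: specializes_toZ (peak_spectrum_value _ _ _ _) h.
Qed.

Lemma row_mnmE : row_mnm N m = peak_mnm one m.
Proof.
apply/mnmP => k; rewrite mnmE peak_mnmE -val_eqE /=.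
by case: (_ == _); rewrite ?mul1n ?mul0n.
Qed.

Variable J : 'rV[{mpoly Qk[N]}]_(ytdim N tau).
Hypothesis hJ : is_jack rho (row_mnm N m) S J.

Lemma jack_eigenfun : gen_eigenfun (gen_spectrum m one E) J.
Proof.
case: hJ => h _ k; apply: etrans (h k) _; congr (_%:MP *: _).
rewrite /zeta row_mnmE rank_perm_peak_first // perm1 peak_mnmE.
by rewrite /peak_spectrum natr1.
Qed.

(** The rank permutation of (m, 0, ..., 0) is the identity. The coefficient does not depend on
    kappa, so multiplying J by a positive power of kappa - k0 makes it vanish at k0. *)
Lemma jack_top_coefficient :
  vcoeff (peak_mnm one m) J = map_mx constQk (ytvec S).
Proof.
case: hJ => _ [v ->]; rewrite row_mnmE rank_perm_peak_first // gen1 mulmx1.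
rewrite vcoeffD vcoeff_tensor mcoeffX eqxx scale1r vcoeff_sum big1 ?addr0 //.
move=> b hb; rewrite vcoeff_tensor mcoeffX.
have [e|_] := eqVneq (bmnm b) (peak_mnm one m); last by rewrite scale0r.
by move: hb; rewrite e mtri_irrefl.
Qed.

Lemma jack_homogeneous : homogeneous_deg m J.
Proof.
move=> b bm; case: hJ => _ [v ->]; rewrite row_mnmE vcoeffD vcoeff_tensor mcoeffX.
have [e|_] := eqVneq (peak_mnm one m) b.
  by move: bm; rewrite -e mdeg_peak_mnm eqxx /=.
rewrite scale0r add0r vcoeff_sum big1 // => b' /andP[/eqP hb' _].
rewrite [LHS]mdeg_peak_mnm in hb'.
rewrite vcoeff_tensor mcoeffX; have [e|_] := eqVneq (bmnm b') b.
  by move: bm; rewrite -e -hb' eqxx /=.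
by rewrite scale0r.
Qed.

Let c_succ s (i j : 'I_N) : j = i.+1 :> nat -> c s i != c s j.
Proof. exact: content_succ_neq. Qed.
Let c_last s (i : 'I_N) : i.+1 = N -> c s i = 0.
Proof. exact: content_last. Qed.

Lemma jack_dunkl_eq0 j : j != one -> dunkl (gen_rep rho) kappa_gen j J = 0.
Proof.
move=> j1; exact: (dunkl_peak_first_eq0 gen1 genM
  (delta_jucys_murphy_gen htau hrho) c_succ c_last kappa_gen_generic one0 j1
  jack_eigenfun).
Qed.

(* A pole of order e + 1 would give, after rescaling and evaluating, a nonzero
   eigenfunction whose top coefficient vanishes. *)
Lemma jack_regular : exists f, specializes_to k0 J f.
Proof.
have [e] := specialization_exists_scaled k0 J.
elim: e => [|e IH] [f hf].
  by exists f; rewrite expr0 mpolyC1 scale1r in hf.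
apply: IH; apply: specializes_to_div; suff f0 : f = 0 by rewrite f0 in hf.
apply/eqP; apply: contraT => /eqP f0.
set t := kappa_sub k0 ^+ e.+1 in hf.
have ht : frac_value k0 t 0.
  by have := frac_valueX e.+1 (frac_value_kappa_sub k0); rewrite expr0n.
have heig : gen_eigenfun (gen_spectrum m one E) (t%:MP *: J).
  move=> k; apply: etrans (cherednikC _ _ _ _ _) _.
  apply: etrans (congr1 (fun g => t%:MP *: g) (jack_eigenfun k)) _.
  by apply: etrans (scalerA _ _ _) _; rewrite mulrC; apply: esym (scalerA _ _ _).
have hom : homogeneous_deg m (t%:MP *: J).
  by move=> b /jack_homogeneous hb; rewrite vcoeffC hb scaler0.
have := top_coefficient_neq0 (homogeneous_specialization hom hf)
  (eigenfun_specialization heig hf) f0.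
rewrite (_ : vcoeff _ f = 0) ?eqxx //; apply/rowP => s.
move/specializes_toE: hf => hf; apply: frac_value_unique (hf _ s) _.
rewrite vcoeffC jack_top_coefficient !mxE -[X in frac_value _ _ X](mul0r (ytvec S 0 s)).
rewrite mxE; apply: frac_valueM ht _; exact: frac_value_const.
Qed.

(** The first factor is the linear factor at 0, which vanishes at k0 exactly if z = 0. Zeros in the
    numerator therefore number (z = 0) plus the entries of content z - 1 or z + 1 after the first,
    against twice those of content z below; [Zhat_content_count] gives one more above. *)
Lemma leading_factor_value : frac_value k0
  ((m%:R + kappa_gen * (content S one)%:~R)
   * \prod_(k < N | (one < k)%N) (1 - (kappa_gen / peak_gap kappa_gen m one E k) ^+ 2))
  0.
Proof.
have h0 := linear_factor_unit hm n0 hn erefl 0.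
have hP := linear_factor_prod hm n0 hn erefl (fun k : 'I_N => (one < k)%N) E.
rewrite /linear_factor subr0 in h0.
apply: unit_times_value0 (unit_timesM h0 hP).
have := Zhat_content_count htau one0 hz.
have cE x : content_count S 1 x
    = (\sum_(k < N | (one < k)%N) (content S k == x))%N.
  rewrite /content_count -sum1_card big_mkcond [RHS]big_mkcond /=.
  by apply: eq_bigr => k _; rewrite inE; case: (0 < k)%N => //=; case: (_ == _).
rewrite !cE -big_distrl big_split /= [0 == z]eq_sym.
move: (\sum_(_ < _ | _) (_ == z))%N (\sum_(_ < _ | _) (_ == z - 1)%R)%N.
by move=> s1 s2; lia.
Qed.

Lemma jack_singular : singular_at rho k0 J.
Proof.
have [f hf] := jack_regular; exists f => // j.
(* These identities hold for generic kappa and pass to the value at k0. *)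
have hD i : i != one -> dunkl rho k0 i f = 0.
  move=> i1; apply: specializes_to_unique (specializes_to_dunkl rho i hf) _.
  rewrite jack_dunkl_eq0 //; exact: specializes_to0.
have [->|] := eqVneq j one; last exact: hD.
have [m' mE] : exists m', m = m'.+1 by exists m.-1; rewrite prednK.
have Jeig : gen_eigenfun (gen_spectrum m'.+1 one E) J.
  by rewrite -mE; apply: jack_eigenfun.
have feig := eigenfun_specialization Jeig hf.
have [_ geig] := eigenfun_dunkl_first rhoM one0 feig hD.
have hg := specializes_to_dunkl rho one hf.
have ghom : homogeneous_deg m' (dunkl rho k0 one f).
  apply: homogeneous_specialization hg; apply: homogeneous_dunkl.
  by rewrite -mE; exact: jack_homogeneous.
(* If D_1 f were nonzero, its coefficient of x_1^(m-1) would be nonzero; but that coefficient is the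
   value at k0 of the leading factor times a constant vector, which is 0. *)
have [//|/eqP g0] := eqVneq (dunkl rho k0 one f) 0.
have := lower_coefficient_neq0 mE ghom geig g0.
rewrite (_ : vcoeff _ _ = 0) ?eqxx //=; apply/rowP => s.
move/specializes_toE: hg => hg; apply: frac_value_unique (hg _ s) _.
rewrite (vcoeff_dunkl_peak gen1 genM (delta_jucys_murphy_gen htau hrho)
  kappa_gen_generic one0 Jeig) => [|k k1]; last first.
  by apply: jack_dunkl_eq0; rewrite -val_eqE /= -lt0n.
rewrite -mE jack_top_coefficient !mxE -[X in frac_value _ _ X](mul0r (ytvec S 0 s)).
rewrite mxE; apply: frac_valueM leading_factor_value _; exact: frac_value_const.
Qed.

End JackSpecialization.

Theorem theorem23 (N : nat) (hN : (2 <= N)%N)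
    (tau : seq nat) (htau : is_partition N tau)
    (rho : 'S_N -> 'M[rat]_(ytdim N tau)) (hrho : is_young_rep rho)
    (S : rsyt N tau) (m : nat) (hm : (1 <= m)%N)
    (J : 'rV[{mpoly Qk[N]}]_(ytdim N tau))
    (hJ : is_jack rho (row_mnm N m) S J)
    (z : int) (hz : z \in Zhat S (first_entry hN))
    (n : int) (hn : n = content S (first_entry hN) - z) (hn0 : n <> 0)
    (hmn : gcdz m%:Z n = 1) :
  singular_at rho (- (m%:R / n%:~R)) J.
Proof. exact: (jack_singular htau hrho hm hz hn hn0 hmn hJ). Qed.
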